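(* Assume that the periodic Riccati equation (Ric) has a period-1 stabilizing solution, and let $\mathscr{M}(\epsilon_2)$ be the compact invariant manifold (with $\epsilon_2$) described in the context. Then $\mathscr{M}(\epsilon_2)$ is a $\rho$-normally hyperbolic invariant manifold, for every $\rho\in\mathbb{N}$, for the Hamiltonian system (Ham).
   Context: Setting. Let $n\ge2$, $m\ge1$, $r\ge4$ be integers. Let $\dot z=f(z)+g(z)u$ be a $C^r$ control system on $\mathbb{R}^n$ ($g(z)$ is $n\times m$, $u\in\mathbb{R}^m$). Suppose $\dot z=f(z)$ has a periodic orbit, of period $1$ after normalizing time, parametrized by a $1$-periodic $C^r$ curve $\gamma:\mathbb{R}/\mathbb{Z}\to\mathbb{R}^n$, one-to-one on $[0,1)$, with $\gamma'(x_0)=f(\gamma(x_0))$. Put $e_0=\gamma'/\|\gamma'\|$ and let $e_1,\dots,e_{n-1}$ be further $1$-periodic vector functions of $x_0$ such that $e_0(x_0),\dots,e_{n-1}(x_0)$ are orthonormal and $Z(x_0)=[e_1(x_0)\ \cdots\ e_{n-1}(x_0)]$ is $C^{r-1}$. The coordinates $\mathbf{x}=(x_0,\mathbf{x}_a)\in\mathbb{R}\times\mathbb{R}^{n-1}$ defined by $z=\gamma(x_0)+Z(x_0)\mathbf{x}_a$ (valid for $\|\mathbf{x}_a\|<\rho_0$, some $\rho_0>0$) transform the system into $$\dot x_0=1+f_0(\mathbf{x})+g_0(\mathbf{x})u,\qquad \dot{\mathbf{x}}_a=A(x_0)\mathbf{x}_a+\mathbf{f}_a(\mathbf{x})+g_a(\mathbf{x})u,$$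 where $f_0$ is scalar, $g_0$ an $m$-row vector, $A$ an $(n-1)\times(n-1)$ matrix, $\mathbf{f}_a\in\mathbb{R}^{n-1}$, $g_a$ an $(n-1)\times m$ matrix. These are $C^{r-2}$ and $1$-periodic in $x_0\in\mathbb{R}$; $|f_0(x_0,\mathbf{x}_a)|=\mathcal{O}(\|\mathbf{x}_a\|)$ as $\|\mathbf{x}_a\|\to0$; $\mathbf{f}_a(x_0,0)=0$ and $\frac{\partial \mathbf{f}_a}{\partial\mathbf{x}_a}(x_0,0)=0$. $Q:\mathbb{R}\to\mathbb{R}^{(n-1)\times(n-1)}$ is $C^r$, $1$-periodic, with positive semi-definite (symmetric) values; $R\in\mathbb{R}^{m\times m}$ is positive definite (symmetric). Hamiltonian system. With $\mathbf{p}=(p_0,\mathbf{p}_a)\in\mathbb{R}\times\mathbb{R}^{n-1}$ and $G(\mathbf{x},\mathbf{p})=g_0(\mathbf{x})^\top p_0+g_a(\mathbf{x})^\top\mathbf{p}_a$, let $$H(\mathbf{x},\mathbf{p})=p_0+p_0f_0(\mathbf{x})-\tfrac14G(\mathbf{x},\mathbf{p})^\top R^{-1}G(\mathbf{x},\mathbf{p})+\mathbf{p}_a^\top(A(x_0)\mathbf{x}_a+\mathbf{f}_a(\mathbf{x}))+\tfrac12\mathbf{x}_a^\top Q(x_0)\mathbf{x}_a.$$ (Ham) denotes Hamilton's equations $\dot{\mathbf{x}}=(\partial H/\partial\mathbf{p})^\top$, $\dot{\mathbf{p}}=-(\partial H/\partial\mathbf{x})^\top$, and $\Phi_H(t,(\mathbf{x},\mathbf{p}))$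 its flow; $D\Phi_H$ is the derivative with respect to the initial point. $\Gamma_0=\{(x_0,0_{2n-1}):x_0\in\mathbb{R}\}$ is invariant. Riccati equation. With $\bar R(t)=\tfrac12g_a(t,0)R^{-1}g_a(t,0)^\top$, $$\text{(Ric)}\qquad\dot P(t)+A(t)^\top P(t)+P(t)A(t)-P(t)\bar R(t)P(t)+Q(t)=0.$$ A period-1 solution $P$ is stabilizing if $\dot x=(A(t)-\bar R(t)P(t))x$ is asymptotically stable at the origin. The manifold. If (Ric) has a period-1 stabilizing solution, there are $\epsilon_1>0$ and $C^{r-2}$ functions $\tau:[-\epsilon_1,\epsilon_1]\to\mathbb{R}$, $\mathbf{a}:[-\epsilon_1,\epsilon_1]\to\mathbb{R}^{2n-1}$ with $\tau(0)=1$, $\mathbf{a}(0)=0$, such that the solution of (Ham) starting at $x_0(0)=0$, $(\mathbf{x}_a(0),\mathbf{p}(0))=\mathbf{a}(e)$ satisfies $x_0(k\tau(e))=k$ for $k\in\mathbb{N}$, has $\tau(e)$-periodic $\mathbf{x}_a(t),\mathbf{p}(t)$, and its trajectory $\Gamma(e)$ lies in $H^{-1}(e)$ with $\Gamma(0)=\Gamma_0$. Let $\mathscr{M}(\epsilon)=\bigcup_{|e|\le\epsilon}\Gamma(e)/\mathbb{Z}$, where $\mathbb{Z}$ acts by integer shifts of $x_0$; it is a 2-dimensional compact $C^{r-1}$ manifold (with boundary) invariant under (Ham). The point of $\Gamma(e)$ with first coordinate $x_0$ is denoted $(x_0,\mathbf{a}(e))$. The number $\epsilon_2\in(0,\epsilon_1)$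 is one for which: at each point $q=(x_0,\mathbf{a}(e))\in\mathscr{M}(\epsilon_2)$ there is a splitting $\mathbb{R}^{2n}=T_q\mathscr{M}(\epsilon_2)\oplus N^s_q\oplus N^u_q$ into $D\Phi_H(\tau(e),q)$-invariant subspaces of dimensions $2,n-1,n-1$ with bases varying continuously in $q$, and there are constants $C>0$, $0<a<1$ with $\|D\Phi_H(\tau(e),q)^kv\|\le C(1+|k|)\|v\|$ for $v\in T_q\mathscr{M}(\epsilon_2)$, $k\in\mathbb{Z}$; $\|D\Phi_H(\tau(e),q)^kv\|\le Ca^k\|v\|$ for $v\in N_q^s$, $k\in\mathbb{N}$; and $\|D\Phi_H(\tau(e),q)^{-k}v\|\le Ca^k\|v\|$ for $v\in N_q^u$, $k\in\mathbb{N}$, for all $q\in\mathscr{M}(\epsilon_2)$. (Such $\epsilon_2$ exists under the stated hypothesis.) Normal hyperbolicity. Let $\ell\ge1$, let $F:\mathbb{R}^N\to\mathbb{R}^N$ ($N\ge3$) be a $C^\ell$ diffeomorphism and let $M\subset\mathbb{R}^N$ be a compact $C^\ell$ submanifold with $F(M)=M$. $M$ is called an $\ell$-normally hyperbolic invariant manifold for $F$ if (i) there is a continuous $DF$-invariant splitting $T\mathbb{R}^N|_M=TM\oplus N^s_M\oplus N^u_M$ (continuous meaning that, as $x$ varies in $M$, continuously varying bases of $N^s_x$ and $N^u_x$ can be found), such that $DF(x)(T_xM)=T_{F(x)}M$, $DF(x)(N^s_x)=N^s_{F(x)}$, $DF(x)(N^u_x)=N^u_{F(x)}$ for $x\in M$;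 and (ii) there are constants $C>0$, $0<a<1$ such that $$\left\|DF^k|_{N^s_x}\right\|\cdot\left\|\left(DF^k|_{T_xM}\right)^{-1}\right\|^{\sigma}<Ca^k,\qquad \left\|\left(DF^k|_{N^u_x}\right)^{-1}\right\|\cdot\left\|DF^k|_{T_xM}\right\|^{\sigma}<Ca^k$$ for $0\le\sigma\le\ell$, $x\in M$, $k\in\mathbb{N}$, where $\|\cdot\|$ is the induced norm of a linear map. That $\mathscr{M}(\epsilon_2)$ is a $\rho$-normally hyperbolic invariant manifold for (Ham) means that it is one (the definition with $\ell=\rho$) for a diffeomorphism induced by the flow of (Ham), with $x_0$ taken modulo $1$, the system being $1$-periodic in $x_0$.
   Formalization: Since r is finite, the flow need not be C^ρ for every ρ; the formal claim gives a C^{r-3} diffeomorphism near the manifold and a C^{r-3} submanifold, with the splitting and rate conditions for 0≤σ≤ρ for every ρ, so it is the stated definition verbatim when ρ≤r-3. *)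

(* Defs.v *)
(* MathComp-Analysis. *)
From HB Require Import structures.
From mathcomp Require Import all_boot all_order all_algebra.
From mathcomp Require Import all_classical all_reals all_analysis.

Set Implicit Arguments.
Unset Strict Implicit.
Unset Printing Implicit Defensive.

Import Order.TTheory GRing.Theory Num.Theory.
Import numFieldNormedType.Exports.

Local Open Scope classical_set_scope.
Local Open Scope ring_scope.

Section Calculus.
Context {R : realType}.

(* The library norm on matrices is the sup norm; this is the Euclidean one. *)
Definition enorm n (v : 'cV[R]_n) : R := Num.sqrt (\sum_i v i 0 ^+ 2).

(* Class C^k on an open set D.  For finite-dimensional V this is the usual
   notion: f is C^(k+1) iff it is differentiable and all its directional
   derivatives are C^k. *)
Fixpoint Ck {V W : normedModType R} (k : nat) (D : set V) (f : V -> W) : Prop :=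
  match k with
  | 0 => forall x, D x -> {for x, continuous f}
  | k'.+1 => (forall x, D x -> differentiable f x) /\
             (forall v : V, Ck k' D ('D_v f))
  end.

(* Class C^k on a closed interval: restriction of a C^k function on the line. *)
Definition Ck_segment {W : normedModType R} (k : nat) (a b : R) (f : R -> W) :=
  exists2 h : R -> W, Ck k setT h & forall t, a <= t <= b -> f t = h t.

Definition Ck_diffeo {V W : normedModType R} (k : nat) (U : set V) (F : V -> W) :=
  [/\ open U, Ck k U F, open (F @` U) &
      exists2 F' : W -> V, Ck k (F @` U) F' & forall x, U x -> F' (F x) = x].

Definition is_solution {V : normedModType R} (X : V -> V) (W : set V)
    (J : set R) (c : R -> V) :=
  forall t : R, J t -> W (c t) /\ is_derive t 1 c (X (c t)).

(* Phi, with domain D, is the (maximal, local) flow of class C^k of the vector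
   field X on the open set W; outside D the values of Phi are irrelevant. *)
Record is_flow {V : normedModType R} (k : nat) (X : V -> V) (W : set V)
    (D : set (R * V)) (Phi : R -> V -> V) : Prop := IsFlow {
  flow_open : open D ;
  flow_Ck : Ck k D (fun tq : R * V => Phi tq.1 tq.2) ;
  flow_dom : forall t q, D (t, q) -> W q ;
  flow_interval : forall q, is_interval [set t | D (t, q)] ;
  flow_init : forall q, W q -> D (0, q) /\ Phi 0 q = q ;
  flow_solution :
    forall q, is_solution X W [set t | D (t, q)] (fun t => Phi t q) ;
  flow_maximal : forall (J : set R) (c : R -> V),
    open J -> is_interval J -> J 0 -> is_solution X W J c ->
    forall t, J t -> D (t, c 0) /\ Phi t (c 0) = c t }.

End Calculus.

Section Submanifolds.
Context {R : realType} {N : nat}.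
Local Notation V := 'cV[R]_N.

(* Embedded dim-dimensional C^k submanifold, possibly with boundary. *)
Definition submanifold (k dim : nat) (M : set V) :=
  forall q, M q -> exists (U : set V) (phi : V -> V),
    [/\ U q, Ck_diffeo k U phi &
      (forall x, U x ->
        (M x <-> forall i : 'I_N, (dim <= i)%N -> phi x i 0 = 0)) \/
      (forall x, U x ->
        (M x <-> (forall i : 'I_N, (dim <= i)%N -> phi x i 0 = 0) /\
                 (forall i : 'I_N, i = 0%N :> nat -> 0 <= phi x i 0)))].

(* One-sided curves, so that boundary points are treated as well. *)
Definition tangent_vector (M : set V) (q v : V) :=
  exists c : R -> V,
    [/\ c 0 = q, \forall t \near 0^'+, M (c t) &
        t^-1 *: (c t - q) @[t --> 0^'+] --> v].

(* E = T_q M, the linear span of the tangent vectors of M at q. *)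
Definition is_tangent_space (M : set V) (q : V) (E : {vspace V}) :=
  (forall v, tangent_vector M q v -> v \in E) /\
  (forall E' : {vspace V},
     (forall v, tangent_vector M q v -> v \in E') -> (E <= E')%VS).

Definition Diff (F : V -> V) (q : V) : 'End(V) := linfun ('d F q).

(* Integer powers of an invertible linear map. *)
Definition lpowz (L : 'End(V)) (k : int) (v : V) : V :=
  match k with
  | Posz j => iter j L v
  | Negz j => iter j.+1 (L^-1)%VF v
  end.

(* Norm of the restriction of L to the subspace E. *)
Definition opnorm_on (L : 'End(V)) (E : {vspace V}) : R :=
  sup [set enorm (L v) | v in [set v | v \in E /\ enorm v <= 1]].

(* The objects below live on the quotient of V by the integer multiples of a
   vector s.  They are represented by their lifts: sets and maps on V which are
   compatible with the translation by s; the case s = 0 is that of V itself. *)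

Definition shift_invariant (s : V) (M : set V) := forall q, M (q + s) <-> M q.

Definition compact_mod (s : V) (M : set V) :=
  exists2 K : set V, compact K &
    M = [set q | exists j : int, K (q + s *~ j)].

(* A family of d-dimensional subspaces E q, q in M, admitting bases that vary
   continuously with q in the quotient of M. *)
Definition continuous_subspaces (s : V) (M : set V) (d : nat)
    (E : V -> {vspace V}) :=
  exists b : 'I_d -> V -> V,
    [/\ forall i, {within M, continuous (b i)},
        forall i q, M q -> b i (q + s) = b i q &
        forall q, M q -> basis_of (E q) [seq b i q | i <- enum 'I_d]].

Definition splits (E1 E2 E3 : {vspace V}) :=
  directv (E1 + E2 + E3) /\ (E1 + E2 + E3 = fullv)%VS.

(* M is an l-normally hyperbolic invariant manifold for F, a diffeomorphism
   between open neighbourhoods U and F(U) of M.  The class C^k of F and M is a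
   separate parameter, since l only enters the rate conditions through the range
   of sigma; the usual definition is the case k = l. *)
Definition normally_hyperbolic (s : V) (k l : nat) (U : set V) (F : V -> V)
    (M : set V) : Prop :=
  [/\ [/\ shift_invariant s U, Ck_diffeo k U F &
          forall q, U q -> F (q + s) = F q + s],
      [/\ M `<=` U, shift_invariant s M, compact_mod s M,
          exists d, submanifold k d M & F @` M = M] &
      exists T Ns Nu : V -> {vspace V},
      [/\ forall q, M q -> is_tangent_space M q (T q),
          forall q, M q -> splits (T q) (Ns q) (Nu q),
          (exists d, continuous_subspaces s M d Ns) /\
          (exists d, continuous_subspaces s M d Nu),
          forall q, M q ->
            [/\ (Diff F q @: T q = T (F q))%VS,
                (Diff F q @: Ns q = Ns (F q))%VS &
                (Diff F q @: Nu q = Nu (F q))%VS] &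
          exists C a : R, [/\ 0 < C, 0 < a < 1 &
            forall (sigma : R) q (j : nat), 0 <= sigma <= l%:R -> M q ->
            let L := Diff (iter j F) q in
            opnorm_on L (Ns q) *
              (opnorm_on (L^-1)%VF (L @: T q)%VS) `^ sigma < C * a ^+ j /\
            opnorm_on (L^-1)%VF (L @: Nu q)%VS *
              (opnorm_on L (T q)) `^ sigma < C * a ^+ j]]].

Definition normally_hyperbolic_flow (s : V) (k l : nat) (D : set (R * V))
    (Phi : R -> V -> V) (M : set V) : Prop :=
  exists2 t : R, 0 < t &
    normally_hyperbolic s k l [set q | D (t, q)] (Phi t) M.

End Submanifolds.

Section ControlSystem.
Context {R : realType}.

Definition symmetric_mx d (S : 'M[R]_d) := S^T = S.
Definition quad d (S : 'M[R]_d) (v : 'cV[R]_d) : R := (v^T *m S *m v) 0 0.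
Definition pos_semidef d (S : 'M[R]_d) := symmetric_mx S /\ forall v, 0 <= quad S v.
Definition pos_def d (S : 'M[R]_d) :=
  symmetric_mx S /\ forall v, v != 0 -> 0 < quad S v.

Definition periodic1 {X : Type} (h : R -> X) := forall t, h (t + 1) = h t.

(* A vector of R x R^k is a column whose first entry is x_0. *)
Definition hd k (z : 'cV[R]_(1 + k)) : R := usubmx z 0 0.
Definition tl k (z : 'cV[R]_(1 + k)) : 'cV[R]_k := dsubmx z.
Definition pt k (t : R) (v : 'cV[R]_k) : 'cV[R]_(1 + k) := col_mx t%:M v.
Definition unit_shift k : 'cV[R]_(1 + k) := pt 1 0.

(* gamma parametrizes a periodic orbit of dz/dt = f(z); the columns of Z are
   e_1, ..., e_(n-1). *)
Record periodic_orbit n (r : nat) (f : 'cV[R]_n -> 'cV[R]_n)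
    (gamma : R -> 'cV[R]_n) (Z : R -> 'M[R]_(n, n.-1)) : Prop := PeriodicOrbit {
  gamma_Ck : Ck r setT gamma ;
  gamma_per : periodic1 gamma ;
  gamma_inj : forall s t, 0 <= s < 1 -> 0 <= t < 1 -> gamma s = gamma t -> s = t ;
  gamma_orbit : forall t : R, is_derive t 1 gamma (f (gamma t)) ;
  Z_Ck : Ck r.-1 setT Z ;
  Z_per : periodic1 Z ;
  frame_orthonormal : forall t,
    let e0 := (enorm (derive1 gamma t))^-1 *: derive1 gamma t in
    (row_mx e0 (Z t))^T *m row_mx e0 (Z t) = 1%:M }.

(* Right-hand side of
     dx_0/dt = 1 + f_0(x) + g_0(x) u,
     dx_a/dt = A(x_0) x_a + f_a(x) + g_a(x) u. *)
Record transverse_system (d m : nat) := TransverseSystem {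
  f0 : 'cV[R]_(1 + d) -> R ;
  g0 : 'cV[R]_(1 + d) -> 'rV[R]_m ;
  A : R -> 'M[R]_d ;
  fa : 'cV[R]_(1 + d) -> 'cV[R]_d ;
  ga : 'cV[R]_(1 + d) -> 'M[R]_(d, m) }.

Definition tube d (rho0 : R) : set 'cV[R]_(1 + d) :=
  [set x | enorm (tl x) < rho0].

(* S is dz/dt = f(z) + g(z) u written in the coordinates x = (x_0, x_a),
   z = gamma(x_0) + Z(x_0) x_a, which are valid for |x_a| < rho0. *)
Record transverse_form n m (r : nat) (f : 'cV[R]_n -> 'cV[R]_n)
    (g : 'cV[R]_n -> 'M[R]_(n, m)) (gamma : R -> 'cV[R]_n)
    (Z : R -> 'M[R]_(n, n.-1)) (rho0 : R) (S : transverse_system n.-1 m) : Prop :=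
  TransverseForm {
  coord_inj : forall x y, tube rho0 x -> tube rho0 y ->
    gamma (hd x) + Z (hd x) *m tl x = gamma (hd y) + Z (hd y) *m tl y ->
    tl x = tl y /\ exists j : int, hd x = hd y + j%:~R ;
  coord_immersion : forall x, tube rho0 x ->
    \rank (row_mx (derive1 gamma (hd x) + derive1 Z (hd x) *m tl x) (Z (hd x))) = n ;
  coord_eq : forall x u, tube rho0 x ->
    let z := gamma (hd x) + Z (hd x) *m tl x in
    (1 + f0 S x + (g0 S x *m u) 0 0) *:
        (derive1 gamma (hd x) + derive1 Z (hd x) *m tl x) +
      Z (hd x) *m (A S (hd x) *m tl x + fa S x + ga S x *m u) =
    f z + g z *m u ;
  f0_Ck : Ck (r - 2) (tube rho0) (f0 S) ;
  g0_Ck : Ck (r - 2) (tube rho0) (g0 S) ;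
  A_Ck : Ck (r - 2) setT (A S) ;
  fa_Ck : Ck (r - 2) (tube rho0) (fa S) ;
  ga_Ck : Ck (r - 2) (tube rho0) (ga S) ;
  A_per : periodic1 (A S) ;
  fg_per : forall x, tube rho0 x ->
    [/\ f0 S (x + unit_shift _) = f0 S x, g0 S (x + unit_shift _) = g0 S x,
        fa S (x + unit_shift _) = fa S x & ga S (x + unit_shift _) = ga S x] ;
  f0_bigO : forall t, exists C : R,
    \forall xa \near (0 : 'cV[R]_n.-1), `|f0 S (pt t xa)| <= C * enorm xa ;
  fa_zero : forall t, fa S (pt t 0) = 0 ;
  fa_diff_zero : forall t v,
    'd (fun xa : 'cV[R]_n.-1 => fa S (pt t xa)) 0 v = 0 }.

(* Phase points are z = (x_0, x_a, p_0, p_a). *)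
Section Hamiltonian.
Variables (d m : nat) (S : transverse_system d m).
Variables (Q : R -> 'M[R]_d) (Rw : 'M[R]_m).
Local Notation phase := 'cV[R]_(1 + (d + (1 + d))).

Definition xa (z : phase) : 'cV[R]_d := usubmx (tl z).
Definition xs (z : phase) : 'cV[R]_(1 + d) := pt (hd z) (xa z).
Definition p0 (z : phase) : R := hd (dsubmx (tl z)).
Definition pa (z : phase) : 'cV[R]_d := tl (dsubmx (tl z)).

Definition phase_domain (rho0 : R) : set phase := [set z | tube rho0 (xs z)].

Definition Gvec (z : phase) : 'cV[R]_m :=
  p0 z *: (g0 S (xs z))^T + (ga S (xs z))^T *m pa z.

Definition Ham (z : phase) : R :=
  p0 z + p0 z * f0 S (xs z) - 4^-1 * quad (invmx Rw) (Gvec z)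
  + ((pa z)^T *m (A S (hd z) *m xa z + fa S (xs z))) 0 0
  + 2^-1 * quad (Q (hd z)) (xa z).

Definition grad (h : phase -> R) (z : phase) : phase :=
  \col_i 'D_(delta_mx i 0) h z.

(* (dx_0/dt, dx_a/dt, dp_0/dt, dp_a/dt)
   = (dH/dp_0, dH/dp_a, - dH/dx_0, - dH/dx_a). *)
Definition Ham_field (z : phase) : phase :=
  let dH := grad Ham z in
  pt (p0 dH) (col_mx (pa dH) (pt (- hd dH) (- xa dH))).

Definition Rbar (t : R) : 'M[R]_d :=
  2^-1 *: (ga S (pt t 0) *m invmx Rw *m (ga S (pt t 0))^T).

Definition riccati_solution (P : R -> 'M[R]_d) :=
  forall t : R, derivable P t 1 /\
    derive1 P t + (A S t)^T *m P t + P t *m A S t - P t *m Rbar t *m P t + Q t = 0.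

(* Asymptotic stability (in the sense of Lyapunov) of the origin for the linear
   system dx/dt = B(t) x. *)
Definition asymptotically_stable (B : R -> 'M[R]_d) :=
  let sol (x : R -> 'cV[R]_d) := forall t : R, is_derive t 1 x (B t *m x t) in
  (forall t0 e, 0 < e -> exists2 delta : R, 0 < delta &
     forall x, sol x -> enorm (x t0) < delta ->
     forall t, t0 <= t -> enorm (x t) < e) /\
  (forall t0, exists2 delta : R, 0 < delta &
     forall x, sol x -> enorm (x t0) < delta -> x t @[t --> +oo] --> (0 : 'cV[R]_d)).

Definition stabilizing_solution (P : R -> 'M[R]_d) :=
  [/\ periodic1 P, riccati_solution P &
      asymptotically_stable (fun t => A S t - Rbar t *m P t)].

End Hamiltonian.

Section Manifold.
Variables (d m : nat) (S : transverse_system d m).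
Variables (Q : R -> 'M[R]_d) (Rw : 'M[R]_m).
Local Notation phase := 'cV[R]_(1 + (d + (1 + d))).
Variables (D : set (R * phase)) (Phi : R -> phase -> phase).

Definition Gamma (a : R -> 'cV[R]_(d + (1 + d))) (e : R) : set phase :=
  [set Phi t (pt 0 (a e)) | t in [set: R]].

(* Lift of the manifold M(eps). *)
Definition Mfd (a : R -> 'cV[R]_(d + (1 + d))) (eps : R) : set phase :=
  [set z | exists2 e, `|e| <= eps & Gamma a e z].

Record periodic_family (r : nat) (eps1 : R) (tau : R -> R)
    (a : R -> 'cV[R]_(d + (1 + d))) : Prop := PeriodicFamily {
  eps1_gt0 : 0 < eps1 ;
  tau_Ck : Ck_segment (r - 2) (- eps1) eps1 tau ;
  a_Ck : Ck_segment (r - 2) (- eps1) eps1 a ;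
  tau0 : tau 0 = 1 ;
  a0 : a 0 = 0 ;
  family_dom : forall e t, `|e| <= eps1 -> D (t, pt 0 (a e)) ;
  family_x0 : forall e (k : nat), `|e| <= eps1 ->
    hd (Phi (k%:R * tau e) (pt 0 (a e))) = k%:R ;
  family_per : forall e t, `|e| <= eps1 ->
    tl (Phi (t + tau e) (pt 0 (a e))) = tl (Phi t (pt 0 (a e))) ;
  family_energy : forall e z, `|e| <= eps1 -> Gamma a e z -> Ham S Q Rw z = e ;
  family_0 : Gamma a 0 = [set pt t 0 | t in [set: R]] }.

(* The splitting over M(eps2) into subspaces invariant under the derivative at q
   of the flow at time tau(e); as Phi (tau e) q = q + unit_shift, this derivative
   is an endomorphism of the tangent space of the quotient at q. *)
Definition monodromy_splitting (tau : R -> R) (a : R -> 'cV[R]_(d + (1 + d)))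
    (eps2 : R) :=
  let M := Mfd a eps2 in
  let s : phase := unit_shift _ in
  exists T Ns Nu : phase -> {vspace phase},
  [/\ forall q, M q -> is_tangent_space M q (T q),
      forall q, M q -> splits (T q) (Ns q) (Nu q),
      [/\ continuous_subspaces s M 2 T, continuous_subspaces s M d Ns &
          continuous_subspaces s M d Nu] &
      exists C c : R, [/\ 0 < C, 0 < c < 1 &
        forall e q, `|e| <= eps2 -> Gamma a e q ->
        let L := Diff (Phi (tau e)) q in
        [/\ [/\ (L @: T q = T q)%VS, (L @: Ns q = Ns q)%VS &
                (L @: Nu q = Nu q)%VS],
            forall v (k : int), v \in T q ->
              enorm (lpowz L k v) <= C * (1 + `|k|%:~R) * enorm v,
            forall v (k : nat), v \in Ns q ->
              enorm (lpowz L k v) <= C * c ^+ k * enorm v &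
            forall v (k : nat), v \in Nu q ->
              enorm (lpowz L (- k%:Z) v) <= C * c ^+ k * enorm v]]].

End Manifold.
End ControlSystem.

(* Main.v *)
Require Import Defs.
From HB Require Import structures.
From mathcomp Require Import all_boot all_order all_algebra.
From mathcomp Require Import all_classical all_reals all_analysis.
From mathcomp Require Import ring lra zify.

Import Order.TTheory GRing.Theory Num.Theory.
Import numFieldNormedType.Exports.

Local Open Scope classical_set_scope.
Local Open Scope ring_scope.

(** The manifold M is a union of orbits of the Hamiltonian flow [Phi] that are
    closed modulo the unit shift s of x_0: the orbit of energy e has period
    tau(e), so the linear map L_q = D Phi(tau(e), q) can be iterated, and the
    splitting T + Ns + Nu at q describes how its powers grow: polynomially on T,
    exponentially on Ns and Nu.  The theorem asks for the same information
    about one diffeomorphism F = Phi_t whose time t does not depend on the orbit.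

    The splitting is invariant under every D Phi_t, although it is only assumed
    invariant under the monodromies.  Indeed D Phi_t(q) conjugates L_q to the
    monodromy at Phi_t(q) ([monodromy_conj]), and each summand is determined by
    the growth of the powers of L_q: a vector lies in Ns if and only if its
    forward iterates decay exponentially ([decay_stable]), in T + Ns if and only
    if they grow at most linearly ([slow_growth_center_stable]), and reversing
    time characterizes Nu and T + Nu.  Such growth conditions survive a conjugacy
    ([dichotomy_transport]).

    For the rates, let Tm bound all the periods and let F = Phi_Tm.  Dividing
    j Tm by the period of q gives D F^j(q) = D Phi_r(q) L_q^k with k >= j and
    0 <= r <= Tm ([cocycle_factor]).  The factor D Phi_r(q) and its inverse are
    bounded uniformly, since M is compact modulo s ([M_Diff_bounded]), hence the
    products of norms that define l-normal hyperbolicity are at most a constant times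
    (1 + k)^l c^k, with c < 1 the contraction constant of the splitting.  This is
    O(b^k) for some b < 1 ([poly_geometric_bound]), and b^k <= b^j
    ([normal_rates]).  The polynomial growth along M thus costs nothing against
    the exponential rates, whatever the power l = rho.

    What remains is to see that the flow has the structure of a group and
    commutes with s, which follow from the maximality of its trajectories
    ([flow_law], [flow_translate]) and from the periodicity of the vector field
    ([Ham_field_shift]); and that the periods are positive and bounded and M is
    compact modulo s, because both depend continuously on the energy
    ([positive_bounded_segment], [orbits_compact_mod]). *)

Set Implicit Arguments.
Unset Strict Implicit.
Unset Printing Implicit Defensive.

(** * The Euclidean norm *)

Section EuclideanNorm.
Context {R : realType} {N : nat}.
Local Notation V := 'cV[R]_N.
Implicit Types (v : V) (L : 'End(V)).

Lemma enorm_ge0 v : 0 <= enorm v.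
Proof. exact: sqrtr_ge0. Qed.

Lemma enorm0 : enorm (0 : V) = 0.
Proof.
by rewrite /enorm big1 ?sqrtr0// => i _; rewrite mxE expr0n.
Qed.

Lemma coord_le_enorm v i : `|v i 0| <= enorm v.
Proof.
rewrite -sqrtr_sqr ler_wsqrtr// (bigD1 i)//= lerDl.
by apply: sumr_ge0 => j _; exact: sqr_ge0.
Qed.

Lemma enorm_eq0 v : enorm v <= 0 -> v = 0.
Proof.
move=> v0; apply/matrixP => i j; rewrite ord1 mxE.
by apply/eqP; rewrite -normr_le0 (le_trans (coord_le_enorm v i)).
Qed.

Lemma enorm_le_sum v : enorm v <= \sum_i `|v i 0|.
Proof.
have S0 : 0 <= \sum_i `|v i 0| by apply: sumr_ge0.
rewrite -[leRHS]ger0_norm// -sqrtr_sqr ler_wsqrtr// expr2 mulr_suml.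
apply: ler_sum => i _; rewrite -real_normK ?num_real// expr2 ler_wpM2l//.
by rewrite (bigD1 i)//= lerDl sumr_ge0.
Qed.

(** An explicit bound for the operator norm that involves only the images of
    finitely many vectors, so that it is uniform as soon as these images are. *)
Definition entry_sum (L : V -> V) : R := \sum_j \sum_i `|L (delta_mx i 0) j 0|.

Lemma entry_sum_ge0 (L : V -> V) : 0 <= entry_sum L.
Proof. by apply: sumr_ge0 => j _; apply: sumr_ge0. Qed.

Lemma enorm_lfun_le L v : enorm (L v) <= entry_sum L * enorm v.
Proof.
apply: (le_trans (enorm_le_sum _)); rewrite mulr_suml; apply: ler_sum => j _.
rewrite {1}[v]matrix_sum_delta linear_sum summxE mulr_suml.
apply: (le_trans (ler_norm_sum _ _ _)); apply: ler_sum => i _.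
rewrite big_ord1 linearZ mxE normrM mulrC ler_wpM2l//; exact: coord_le_enorm.
Qed.

Lemma opnorm_on_le L (E : {vspace V}) (B : R) : 0 <= B ->
  (forall v, v \in E -> enorm (L v) <= B * enorm v) -> opnorm_on L E <= B.
Proof.
move=> B0 LB; apply: ge_sup.
  by exists (enorm (L 0)), 0 => //; split; rewrite ?mem0v// enorm0 ler01.
move=> _ [v [vE v1] <-]; rewrite (le_trans (LB _ vE))//.
by rewrite -[leRHS]mulr1 ler_wpM2l.
Qed.

Lemma opnorm_on_ge0 L (E : {vspace V}) : 0 <= opnorm_on L E.
Proof.
rewrite /opnorm_on; apply: (@le_trans _ _ (enorm (L 0))).
  exact: enorm_ge0.
apply: ub_le_sup; last first.
  by exists 0 => //; split; rewrite ?mem0v// enorm0 ler01.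
exists (entry_sum L) => _ [v [_ v1] <-].
by rewrite (le_trans (enorm_lfun_le L v))// ler_piMr ?entry_sum_ge0.
Qed.

End EuclideanNorm.

(** * Maps of class C^k *)

Section CkCalculus.
Context {R : realType}.

Lemma Ck_continuous {V W : normedModType R} k (D : set V) (f : V -> W) x :
  Ck k D f -> D x -> {for x, continuous f}.
Proof.
case: k => [|k] /=; first by move=> Cf; exact: Cf.
by move=> [df _] /df; exact: differentiable_continuous.
Qed.

Lemma Ck_le {V W : normedModType R} k l (D : set V) (f : V -> W) :
  (k <= l)%N -> Ck l D f -> Ck k D f.
Proof.
elim: k l f => [|k IH] l f kl Cf; first by move=> x Dx; exact: Ck_continuous Cf Dx.
case: l kl Cf => // l kl [df Cf]; split => // v; exact: IH (Cf v).
Qed.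

(** A directional derivative only sees the map along a line, which may be
    parametrized from another space. *)
Lemma derive_along {U V W : normedModType R} (f : U -> W) (g : V -> W) a b v w :
  (forall h : R, f (h *: v + a) = g (h *: w + b)) -> 'D_v f a = 'D_w g b.
Proof.
move=> fg; have fgab : f a = g b by have := fg 0; rewrite !scale0r !add0r.
rewrite /derive (_ : (fun h => _) =
  fun h => h^-1 *: ((g \o shift b) (h *: w) - g b))//.
by apply/funext => h /=; rewrite fg fgab.
Qed.

Lemma Ck_slice {V W : normedModType R} k (D : set (R * V)) (f : R * V -> W) (t : R) :
  Ck k D f -> Ck k [set q | D (t, q)] (fun q => f (t, q)).
Proof.
have dp q : differentiable (fun q : V => (t, q)) q.
  by apply: differentiable_pair => //; exact: differentiable_cst.
elim: k f => [|k IH] f /=.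
  move=> Cf q /Cf Cq; apply: (@continuous_comp _ _ _ (fun q : V => (t, q)) f) => //.
  exact: differentiable_continuous (dp q).
move=> [df Cf]; split.
  move=> q /df dfq.
  exact: (differentiable_comp (f := fun q : V => (t, q)) (dp q) dfq).
move=> v; rewrite (_ : 'D_v _ = fun q => 'D_(0, v) f (t, q)); first exact: IH (Cf _).
apply/funext => q; apply: derive_along => h.
by congr f; rewrite [RHS]surjective_pairing /= scaler0 add0r.
Qed.

End CkCalculus.

Lemma Ck_diffeo_le {R : realType} {V W : normedModType R} (k l : nat)
    (U : set V) (F : V -> W) : (k <= l)%N -> Ck_diffeo l U F -> Ck_diffeo k U F.
Proof.
move=> kl [oU CF oFU [F' CF' FK]]; split => //; first exact: Ck_le CF.
by exists F' => //; exact: Ck_le CF'.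
Qed.

Lemma submanifold_le {R : realType} {N : nat} (k l d : nat) (M : set 'cV[R]_N) :
  (k <= l)%N -> submanifold l d M -> submanifold k d M.
Proof.
move=> kl subM q /subM[U [phi [Uq dphi MU]]]; exists U, phi; split => //.
exact: Ck_diffeo_le dphi.
Qed.

(** * The local flow of a vector field *)

Lemma is_derive_along {R : realType} {U V W : normedModType R}
    (f : U -> W) (g : V -> W) a b v w l :
  (forall h : R, f (h *: v + a) = g (h *: w + b)) ->
  is_derive b w g l -> is_derive a v f l.
Proof.
move=> fg [gl <-]; have fgab : f a = g b.
  by have := fg 0; rewrite !scale0r !add0r.
apply: DeriveDef; last exact: derive_along.
suff: (fun h => h^-1 *: ((f \o shift a) (h *: v) - f a)) =
      (fun h => h^-1 *: ((g \o shift b) (h *: w) - g b)).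
  by rewrite /derivable => ->.
by apply/funext => h /=; rewrite fg fgab.
Qed.

Section FlowLaws.
Context {R : realType} {V : normedModType R}.
Variables (k : nat) (X : V -> V) (W : set V) (D : set (R * V)).
Variables (Phi : R -> V -> V) (hPhi : is_flow k X W D Phi).

Lemma flow_domE q : W q <-> D (0, q).
Proof.
by split=> [/(flow_init hPhi)[]//|]; exact: (flow_dom hPhi).
Qed.

Lemma open_slice (t : R) : open [set q | D (t, q)].
Proof.
apply: (@open_comp _ _ (fun q : V => (t, q)) D); last exact: flow_open hPhi.
by move=> q' _; apply: (cvg_pair (cvg_cst t) cvg_id).
Qed.

Lemma open_dom : open W.
Proof.
rewrite (_ : W = [set q | D (0, q)]); first exact: open_slice.
by apply/funext => q; apply/propext; exact: flow_domE.
Qed.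

(** The translate in time of the trajectory of q starts at Phi t q, so it is part of
    the maximal trajectory of that point. *)
Lemma flow_law q t u : D (t, q) -> D (u + t, q) ->
  D (u, Phi t q) /\ Phi u (Phi t q) = Phi (u + t) q.
Proof.
move=> Dt Dut; have := @flow_maximal _ _ _ _ _ _ _ hPhi
  [set v | D (v + t, q)] (fun v => Phi (v + t) q).
rewrite /= add0r; apply => //.
- apply: (@open_comp _ _ (fun v : R => (v + t, q)) D);
    last exact: flow_open hPhi.
  by move=> v _; apply: (cvg_pair (cvgD cvg_id (cvg_cst t)) (cvg_cst q)).
- move=> x y /= Dx Dy z /andP[xz zy].
  by apply: (@flow_interval _ _ _ _ _ _ _ hPhi q _ _ Dx Dy); rewrite /= !lerD2r xz.
- move=> v /= Dv; have [? dPhi] := flow_solution hPhi Dv; split => //.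
  apply: is_derive_along dPhi => h.
  by rewrite /= addrA.
Qed.

Lemma flow_back q t : D (t, q) ->
  D (- t, Phi t q) /\ Phi (- t) (Phi t q) = q.
Proof.
move=> Dt; have [D0 Phi0] := flow_init hPhi (flow_dom hPhi Dt).
by have := @flow_law q t (- t) Dt; rewrite addNr Phi0; exact.
Qed.

Lemma flow_image (t : R) :
  Phi t @` [set q | D (t, q)] = [set q | D (- t, q)].
Proof.
apply/seteqP; split => q /=; first by move=> [p /flow_back[? _] <-].
by move=> /flow_back; rewrite opprK => -[Dt Phit]; exists (Phi (- t) q).
Qed.

Lemma flow_diffeo (t : R) : Ck_diffeo k [set q | D (t, q)] (Phi t).
Proof.
split; first exact: open_slice.
- exact: (@Ck_slice R V V k D _ t (flow_Ck hPhi)).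
- by rewrite flow_image; exact: open_slice.
exists (Phi (- t)); last by move=> q /flow_back[].
by rewrite flow_image; exact: (@Ck_slice R V V k D _ (- t) (flow_Ck hPhi)).
Qed.

(** Translating a trajectory by a symmetry of the field gives a trajectory,
    which maximality identifies with the flow line of its initial point. *)
Lemma flow_translate s : (forall q, W q -> W (q + s) /\ X (q + s) = X q) ->
  forall t q, D (t, q) -> D (t, q + s) /\ Phi t (q + s) = Phi t q + s.
Proof.
move=> Xs t q Dt.
have [D0 Phi0] := flow_init hPhi (flow_dom hPhi Dt).
have := @flow_maximal _ _ _ _ _ _ _ hPhi
  [set v | D (v, q)] (fun v => Phi v q + s).
rewrite /= Phi0; apply => //.
- apply: (@open_comp _ _ (fun v : R => (v, q)) D);
    last exact: flow_open hPhi.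
  by move=> v _; apply: (cvg_pair cvg_id (cvg_cst q)).
- exact: (flow_interval hPhi).
- move=> v /= Dv; have [Wv dPhi] := flow_solution hPhi Dv.
  have [? ->] := Xs _ Wv; split => //.
  rewrite -[X _]addr0; apply: is_deriveD.
Qed.

End FlowLaws.

(** * The differential of the flow *)

Section Differential.
Context {R : realType} {N : nat}.
Local Notation V := 'cV[R]_N.
Implicit Types (F G : V -> V) (q v : V).

Lemma DiffE F q v : Diff F q v = 'd F q v.
Proof. exact: lfunE. Qed.

Lemma Diff_deriveE F q v : differentiable F q -> Diff F q v = 'D_v F q.
Proof. by move=> dF; rewrite DiffE deriveE. Qed.

Lemma Diff_comp F G q : differentiable F q -> differentiable G (F q) ->
  Diff (G \o F) q = (Diff G (F q) \o Diff F q)%VF.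
Proof.
move=> dF dG; apply/lfunP => v.
have E1 : Diff (G \o F) q v = 'd (G \o F) q v := DiffE _ _ _.
have E2 : 'd (G \o F) q v = 'd G (F q) ('d F q v) :=
  congr1 (fun h : V -> V => h v) (diff_comp dF dG).
have E3 : Diff F q v = 'd F q v := DiffE _ _ _.
have E4 : Diff G (F q) ('d F q v) = 'd G (F q) ('d F q v) := DiffE _ _ _.
have E5 := comp_lfunE (Diff G (F q)) (Diff F q) v.
apply: (etrans E1 (etrans E2 (esym (etrans E5 _)))).
exact: (etrans (congr1 (Diff G (F q)) E3) E4).
Qed.

Lemma Diff_near F G q : differentiable F q -> differentiable G q ->
  (\near q, F q = G q) -> Diff F q = Diff G q.
Proof.
move=> dF dG FG; apply/lfunP => v.
exact: etrans (Diff_deriveE v dF)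
  (etrans (near_eq_derive v FG) (esym (Diff_deriveE v dG))).
Qed.

Lemma Diff_id q : Diff id q = \1%VF.
Proof.
apply/lfunP => v; apply: etrans (DiffE _ _ _) _.
by apply/esym/(etrans (id_lfunE _)); rewrite diff_val.
Qed.

End Differential.

Lemma coord_le_norm {R : realType} {m n : nat} (x : 'M[R]_(m, n)) i j :
  `|x i j| <= `|x|.
Proof.
by rewrite [leRHS]/Num.norm /= mx_normrE; apply/bigmax_geP; right; exists (i, j).
Qed.

Section FlowDifferential.
Context {R : realType} {N : nat}.
Local Notation V := 'cV[R]_N.
Variables (k : nat) (X : V -> V) (W : set V) (D : set (R * V)).
Variables (Phi : R -> V -> V) (hPhi : is_flow k.+1 X W D Phi).

Lemma flow_differentiable t q : D (t, q) -> differentiable (Phi t) q.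
Proof.
have [dPhi _] := @Ck_slice R V V k.+1 D _ t (flow_Ck hPhi).
by move=> /dPhi.
Qed.

Lemma Diff_flow_law q t u : D (t, q) -> D (u + t, q) ->
  Diff (Phi (u + t)) q = (Diff (Phi u) (Phi t q) \o Diff (Phi t) q)%VF.
Proof.
move=> Dt Dut; have [Du _] := flow_law hPhi Dt Dut.
have dt := flow_differentiable Dt; have du := flow_differentiable Du.
apply: (etrans _ (Diff_comp dt du)); apply: Diff_near.
- exact: flow_differentiable.
- exact: differentiable_comp.
have := open_nbhs_nbhs (conj (@open_slice _ _ _ _ _ _ _ hPhi (u + t)) Dut).
have := open_nbhs_nbhs (conj (@open_slice _ _ _ _ _ _ _ hPhi t) Dt).
apply: filterS2 => p /= Dtp Dutp.
by have [_ ->] := flow_law hPhi Dtp Dutp.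
Qed.

Lemma Diff_flow0 q : W q -> Diff (Phi 0) q = \1%VF.
Proof.
move=> Wq; have /(flow_domE hPhi) D0 := Wq.
apply: (etrans _ (Diff_id q)); apply: Diff_near.
- exact: flow_differentiable.
- exact: ex_diff.
have := open_nbhs_nbhs (conj (open_dom hPhi) Wq).
by apply: filterS => p /= /(flow_init hPhi)[_ ->].
Qed.

Lemma Diff_flowK q t : D (t, q) ->
  (Diff (Phi (- t)) (Phi t q) \o Diff (Phi t) q = \1)%VF.
Proof.
move=> Dt; have Wq := flow_dom hPhi Dt; have /(flow_domE hPhi) D0 := Wq.
apply: (etrans (esym (Diff_flow_law Dt _))); first by rewrite addNr.
by rewrite addNr; exact: Diff_flow0.
Qed.

Lemma Diff_flow_translate s :
    (forall q, W q -> W (q + s) /\ X (q + s) = X q) ->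
  forall t q, D (t, q) -> Diff (Phi t) (q + s) = Diff (Phi t) q.
Proof.
move=> Xs t q Dt; apply/lfunP => v.
have [Dts _] := flow_translate hPhi Xs Dt.
have dt := flow_differentiable Dt; have dts := flow_differentiable Dts.
apply: (etrans (Diff_deriveE v dts)).
apply: etrans (esym (Diff_deriveE v dt)).
rewrite (@derive_along _ _ _ _ _ (Phi t \o shift s) _ q _ v); last first.
  by move=> h; rewrite /= addrA.
rewrite (@near_eq_derive _ _ _ _ (Phi t + cst s)).
  rewrite deriveD ?derive_cst ?addr0//; exact: diff_derivable.
have := open_nbhs_nbhs (conj (@open_slice _ _ _ _ _ _ _ hPhi t) Dt).
by apply: filterS => p /= Dp; have [_ ->] := flow_translate hPhi Xs Dp.
Qed.

(** The entries of the differential are partial derivatives of the joint map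
    (t, q) |-> Phi t q, which are continuous because it is at least C^1. *)
Lemma Diff_flow_bounded (C : set (R * V)) : compact C -> C `<=` D ->
  exists B, forall t q, C (t, q) -> entry_sum (Diff (Phi t) q) <= B.
Proof.
move=> cC CD; pose Psi (tq : R * V) := Phi tq.1 tq.2.
have [_ CPsi] := flow_Ck hPhi.
have DE t q v : C (t, q) -> Diff (Phi t) q v = 'D_(0, v) Psi (t, q).
  move=> /CD Dt; apply: etrans (Diff_deriveE v (flow_differentiable Dt)) _.
  by apply: derive_along => h; rewrite /Psi /= scaler0 add0r.
have /choice[b bP] (i : 'I_N) : exists b, forall t q, C (t, q) ->
    `|Diff (Phi t) q (delta_mx i 0)| <= b.
  have : compact ('D_(0, delta_mx i 0) Psi @` C).
    apply: continuous_compact => //; apply: continuous_in_subspaceT.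
    by move=> tq; rewrite inE => /CD Dtq; exact: Ck_continuous (CPsi _) Dtq.
  move=> /compact_bounded[M [_ bM]]; exists (M + 1) => t q Ctq.
  rewrite DE//; apply: bM; first by rewrite ltrDl.
  by exists (t, q).
exists (\sum_(j < N) \sum_i b i) => t q Ctq.
apply: ler_sum => j _; apply: ler_sum => i _.
by apply: le_trans (bP _ _ _ Ctq); exact: coord_le_norm.
Qed.

End FlowDifferential.

(** * Splittings characterized by growth *)

Section GrowthArithmetic.
Context {R : realType}.

(** The left side is at most the geometric sum 1 + b + ... + b^k. *)
Lemma linear_geometric_bounded (b : R) k : 0 < b < 1 ->
  (1 + k%:R) * b ^+ k <= (1 - b)^-1.
Proof.
move=> /andP[b0 b1]; have b1' : 0 < 1 - b by rewrite subr_gt0.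
rewrite -[leRHS]mul1r ler_pdivlMr//.
have -> : (1 + k%:R) * b ^+ k = \sum_(i < k.+1) b ^+ k.
  by rewrite sumr_const card_ord mulrDl mul1r mulr_natl mulrS.
apply: (@le_trans _ _ ((\sum_(i < k.+1) b ^+ i) * (1 - b))).
  rewrite ler_wpM2r ?(ltW b1')//; apply: ler_sum => i _.
  by rewrite ler_wiXn2l ?(ltW b0) ?(ltW b1)// -ltnS.
have -> : (\sum_(i < k.+1) b ^+ i) * (1 - b) = 1 - b ^+ k.+1.
  rewrite -opprB mulrN mulrC -subrX1 opprB//.
by rewrite gerBl exprn_ge0// ltW.
Qed.

(** An (l+1)-st root b of c leaves l factors b^k to absorb the l linear
    factors, and one to decay. *)
Lemma poly_geometric_bound (c : R) (l : nat) : 0 < c < 1 ->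
  exists b K : R, [/\ 0 < b < 1, 0 < K &
    forall k : nat, (1 + k%:R) ^+ l * c ^+ k <= K * b ^+ k].
Proof.
move=> /andP[c0 c1]; pose b := c `^ (l.+1%:R^-1).
have b0 : 0 < b by rewrite powR_gt0.
have bl : b ^+ l.+1 = c.
  by rewrite -powR_mulrn ?(ltW b0)// /b -powRrM mulVf ?pnatr_eq0// powRr1 ?ltW.
have b1 : b < 1.
  rewrite ltNge; apply/negP => /(exprn_ege1 l.+1).
  by rewrite bl leNgt c1.
exists b, ((1 - b)^-1 ^+ l); split; rewrite ?b0//.
  by rewrite exprn_gt0// invr_gt0 subr_gt0.
move=> k; rewrite -bl -exprM mulnC exprM exprSr [leLHS]mulrA.
rewrite ler_wpM2r ?exprn_ge0 ?(ltW b0)// -exprMn.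
apply: lerXn2r; rewrite ?nnegrE.
- by rewrite mulr_ge0 ?exprn_ge0 ?(ltW b0)// addr_ge0.
- by rewrite invr_ge0 subr_ge0 ltW.
- by apply: linear_geometric_bounded; rewrite b0.
Qed.

Lemma le0_harmonic (x M : R) :
  (forall k : nat, (1 + k%:R) * x <= M) -> x <= 0.
Proof.
move=> xM; rewrite leNgt; apply/negP => x0.
have := xM (Num.truncn (M / x)); apply/negP; rewrite -ltNge.
rewrite -ltr_pdivrMr// addrC natr1; exact: truncnS_gt.
Qed.

End GrowthArithmetic.

Section Dichotomy.
Context {R : realType} {N : nat}.
Local Notation V := 'cV[R]_N.
Implicit Types (L A : 'End(V)) (E : {vspace V}) (v : V).

Lemma iter_lfunD L k v w : iter k L (v + w) = iter k L v + iter k L w.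
Proof. by elim: k => //= k ->; rewrite linearD. Qed.

Lemma iter_mem L E k v : (forall v, v \in E -> L v \in E) ->
  v \in E -> iter k L v \in E.
Proof. by move=> LE vE; elim: k => //= k; exact: LE. Qed.

(** The projection P onto E1 along E2 commutes with L, so that the iterates of v1
    are the projections of those of v1 + v2.  If v1 is recovered from its k-th
    iterate at cost al k, then |v1| <= |P| al k be k, which tends to 0. *)
Lemma component_eq0 L E1 E2 v1 v2 (al be : nat -> R) (M : R) :
  (E1 :&: E2 = 0)%VS ->
  (forall v, v \in E1 -> L v \in E1) -> (forall v, v \in E2 -> L v \in E2) ->
  v1 \in E1 -> v2 \in E2 ->
  (forall k, 0 <= al k) ->
  (forall k, enorm v1 <= al k * enorm (iter k L v1)) ->
  (forall k, enorm (iter k L (v1 + v2)) <= be k) ->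
  (forall k, (1 + k%:R) * (al k * be k) <= M) -> v1 = 0.
Proof.
move=> E12 L1 L2 v1E v2E al0 v1al vbe albe.
pose P := daddv_pi E1 E2; apply/enorm_eq0/(@le0_harmonic _ _ (entry_sum P * M)).
move=> k.
have Pk : P (iter k L (v1 + v2)) = iter k L v1.
  have k1 : iter k L v1 \in E1 by exact: iter_mem.
  have k2 : iter k L v2 \in E2 by exact: iter_mem.
  rewrite iter_lfunD linearD /= /P daddv_pi_id//.
  have := daddv_pi_add E12 (subvP (addvSr E1 E2) _ k2).
  rewrite (@daddv_pi_id _ _ E2 E1) 1?capvC//.
  by move=> /(canRL (addrK _)); rewrite subrr => ->; rewrite addr0.
apply: (@le_trans _ _ ((1 + k%:R) * (al k * (entry_sum P * be k)))).
  rewrite ler_wpM2l ?addr_ge0//; apply: (le_trans (v1al k)).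
  rewrite ler_wpM2l// -Pk; apply: (le_trans (enorm_lfun_le _ _)).
  by rewrite ler_wpM2l ?entry_sum_ge0.
rewrite [al k * _]mulrCA [leLHS]mulrCA ler_wpM2l ?entry_sum_ge0//; exact: albe.
Qed.

Definition invariant_under L L' E :=
  (forall v, v \in E -> L v \in E) /\ (forall v, v \in E -> L' v \in E).

(** A partially hyperbolic splitting of the automorphism L into center, stable and
    unstable spaces.  The inverse L' of L is a parameter so that the notion is
    visibly symmetric under time reversal ([dichotomy_inv]); and disjointness is
    required of each summand from the sum of the other two, the form in which it
    is used. *)
Record dichotomy (C c : R) (L L' : 'End(V)) (T Ns Nu : {vspace V}) : Prop :=
  Dichotomy {
  dich_K : cancel L L' ;
  dich_K' : cancel L' L ;
  dich_disjT : (T :&: (Ns + Nu) = 0)%VS ;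
  dich_disjs : (Ns :&: (T + Nu) = 0)%VS ;
  dich_disju : (Nu :&: (T + Ns) = 0)%VS ;
  dich_full : (T + Ns + Nu = fullv)%VS ;
  dich_invT : invariant_under L L' T ;
  dich_invs : invariant_under L L' Ns ;
  dich_invu : invariant_under L L' Nu ;
  dich_T : forall v k, v \in T -> enorm (iter k L v) <= C * (1 + k%:R) * enorm v ;
  dich_T' : forall v k, v \in T -> enorm (iter k L' v) <= C * (1 + k%:R) * enorm v ;
  dich_s : forall v k, v \in Ns -> enorm (iter k L v) <= C * c ^+ k * enorm v ;
  dich_u : forall v k, v \in Nu -> enorm (iter k L' v) <= C * c ^+ k * enorm v }.

Lemma iterK L L' k : cancel L L' -> cancel (iter k L) (iter k L').
Proof. by move=> LK; elim: k => // k IH v; rewrite iterSr /= LK IH. Qed.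

Lemma dichotomy_inv C c L L' T Ns Nu :
  dichotomy C c L L' T Ns Nu -> dichotomy C c L' L T Nu Ns.
Proof.
move=> [LK LK' dT ds du full [iT iT'] [j j'] [iu iu'] bT bT' bs bu].
split; rewrite //; [by rewrite addvC|].
by rewrite -addvA [(Nu + Ns)%VS]addvC addvA.
Qed.

Lemma add_invariant L L' E1 E2 : invariant_under L L' E1 ->
  invariant_under L L' E2 -> invariant_under L L' (E1 + E2).
Proof.
move=> [i1 i1'] [i2 i2']; split => _ /memv_addP[v1 v1E [v2 v2E ->]].
  by rewrite linearD memv_add ?i1 ?i2.
by rewrite linearD memv_add ?i1' ?i2'.
Qed.

Section Characterization.
Variables (C c : R) (L L' : 'End(V)) (T Ns Nu : {vspace V}).
Hypotheses (C0 : 0 < C) (c01 : 0 < c < 1).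
Hypothesis dich : dichotomy C c L L' T Ns Nu.

Lemma dich_decomp v : exists t s u,
  [/\ t \in T, s \in Ns, u \in Nu & v = t + s + u].
Proof.
have : v \in (T + Ns + Nu)%VS by rewrite (dich_full dich) memvf.
by case/memv_addP=> _ /memv_addP[t tT [s sN ->]] [u uN ->]; exists t, s, u.
Qed.

Let c0 : 0 <= c. Proof. by case/andP: c01 => /ltW. Qed.

(** The component u of v along Nu vanishes, as |u| <= C c^k |L^k u|. *)
Lemma slow_growth_center_stable v (K : R) : 0 <= K ->
  (forall k, enorm (iter k L v) <= K * (1 + k%:R)) -> v \in (T + Ns)%VS.
Proof.
move=> K0 vK; have [t [s [u [tT sN uN vE]]]] := dich_decomp v.
have [b [K1 [/andP[b0 b1] K10 bK]]] := poly_geometric_bound 2 c01.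
have [iu iu'] := dich_invu dich.
suff u0 : u = 0 by rewrite vE u0 addr0 memv_add.
apply: (@component_eq0 L Nu (T + Ns)%VS u (t + s)
  (fun k => C * c ^+ k) (fun k => K * (1 + k%:R)) (C * K * K1)) => //.
- exact: dich_disju dich.
- by have [] := add_invariant (dich_invT dich) (dich_invs dich).
- exact: memv_add.
- by move=> k; rewrite mulr_ge0 ?exprn_ge0// ltW.
- move=> k; rewrite -[in leLHS](iterK k (dich_K dich) u).
  by apply: (dich_u dich); exact: iter_mem.
- by move=> k; rewrite addrC -vE.
- move=> k; have -> : (1 + k%:R) * (C * c ^+ k * (K * (1 + k%:R))) =
    C * K * ((1 + k%:R) ^+ 2 * c ^+ k) by ring.
  rewrite ler_wpM2l ?mulr_ge0 ?(ltW C0)//; apply: (le_trans (bK k)).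
  by rewrite ler_piMr ?(ltW K10)// exprn_ile1 ?ltW.
Qed.

(** Exponential decay is slow growth, which removes the component along Nu; the
    component t along T goes as well, since |t| <= C (1 + k) |L^k t|. *)
Lemma decay_stable v (K : R) : 0 <= K ->
  (forall k, enorm (iter k L v) <= K * c ^+ k) -> v \in Ns.
Proof.
move=> K0 vK.
have /memv_addP[t tT [s sN vE]] : v \in (T + Ns)%VS.
  apply: (slow_growth_center_stable K0) => k; apply: (le_trans (vK k)).
  rewrite ler_wpM2l// (@le_trans _ _ 1) ?lerDl// exprn_ile1//.
  by case/andP: c01 => _ /ltW.
have [b [K1 [/andP[b0 b1] K10 bK]]] := poly_geometric_bound 2 c01.
suff t0 : t = 0 by rewrite vE t0 add0r.
have [iT iT'] := dich_invT dich.
apply: (@component_eq0 L T (Ns + Nu)%VS t s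
  (fun k => C * (1 + k%:R)) (fun k => K * c ^+ k) (C * K * K1)) => //.
- exact: dich_disjT dich.
- by have [] := add_invariant (dich_invs dich) (dich_invu dich).
- exact: subvP (addvSl _ _) _ sN.
- by move=> k; rewrite mulr_ge0 ?addr_ge0// ltW.
- move=> k; rewrite -[in leLHS](iterK k (dich_K dich) t).
  by apply: (dich_T' dich); exact: iter_mem.
- by move=> k; rewrite -vE.
- move=> k; have -> : (1 + k%:R) * (C * (1 + k%:R) * (K * c ^+ k)) =
    C * K * ((1 + k%:R) ^+ 2 * c ^+ k) by ring.
  rewrite ler_wpM2l ?mulr_ge0 ?(ltW C0)//; apply: (le_trans (bK k)).
  by rewrite ler_piMr ?(ltW K10)// exprn_ile1 ?ltW.
Qed.

End Characterization.
End Dichotomy.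

(** * Transport of a splitting by a conjugacy *)

Section Transport.
Context {R : realType} {N : nat}.
Local Notation V := 'cV[R]_N.

Lemma lker0_surj (L : 'End(V)) : (L @: fullv = fullv)%VS -> lker L == 0%VS.
Proof.
move=> Lf; have := limg_ker_dim L fullv; rewrite Lf capfv => /eqP.
by rewrite -[X in _ == X]add0n eqn_add2r dimv_eq0.
Qed.

Lemma invariant_under_lker0 (L : 'End(V)) (E : {vspace V}) : lker L == 0%VS ->
  (L @: E = E)%VS -> invariant_under L (L^-1)%VF E.
Proof.
move=> L0 LE; split=> v vE; first by rewrite -LE memv_img.
by move: vE; rewrite -{1}LE => /memv_imgP[w wE ->]; rewrite lker0_lfunK.
Qed.

Lemma lpowzN (L : 'End(V)) k v : lpowz L (- k%:Z) v = iter k (L^-1)%VF v.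
Proof. by case: k. Qed.

Lemma dichotomy_of_splitting (C c : R) (L : 'End(V)) (T Ns Nu : {vspace V}) :
  splits T Ns Nu ->
  [/\ (L @: T = T)%VS, (L @: Ns = Ns)%VS & (L @: Nu = Nu)%VS] ->
  (forall v (k : int), v \in T ->
    enorm (lpowz L k v) <= C * (1 + `|k|%:~R) * enorm v) ->
  (forall v (k : nat), v \in Ns ->
    enorm (lpowz L k v) <= C * c ^+ k * enorm v) ->
  (forall v (k : nat), v \in Nu ->
    enorm (lpowz L (- k%:Z) v) <= C * c ^+ k * enorm v) ->
  dichotomy C c L (L^-1)%VF T Ns Nu.
Proof.
move=> [dir full] [LT Ls Lu] bT bs bu.
have L0 : lker L == 0%VS by apply: lker0_surj; rewrite -full !limgD LT Ls Lu.
move: dir; rewrite directv_addE /= directv_addE /=.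
move=> /and3P[/and3P[_ _ /eqP TN] _ /eqP TNN].
split=> //; try exact: invariant_under_lker0.
- exact: lker0_lfunK.
- exact: lker0_lfunVK.
- apply/eqP; rewrite -subv0; apply/subvP => v /memv_capP[vT].
  move=> /memv_addP[s sN [u uN vE]].
  have u0 : u = 0.
    apply/eqP; rewrite -memv0 -TNN memv_cap uN andbT.
    by rewrite -(addKr s u) -vE addrC memv_add// memvN.
  by rewrite -TN memv_cap vT vE u0 addr0.
- apply/eqP; rewrite -subv0; apply/subvP => v /memv_capP[vN].
  move=> /memv_addP[t tT [u uN vE]].
  have u0 : u = 0.
    apply/eqP; rewrite -memv0 -TNN memv_cap uN andbT.
    by rewrite -(addKr t u) -vE memv_add// memvN.
  by rewrite -TN memv_cap vN vE u0 addr0 tT.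
- by rewrite capvC.
- by move=> v k vT; apply: bT (k%:Z) vT.
- move=> v k vT; rewrite -lpowzN; apply: le_trans (bT _ (- k%:Z) vT) _.
  by rewrite normrN.
- by move=> v k vN; rewrite -lpowzN; exact: bu.
Qed.

Section Conjugation.
Variables (C c : R) (C0 : 0 < C) (c01 : 0 < c < 1).

Lemma iter_conj (A L M : 'End(V)) : (forall v, A (L v) = M (A v)) ->
  forall k v, A (iter k L v) = iter k M (A v).
Proof. by move=> ALM; elim=> //= k IH v; rewrite ALM IH. Qed.

Lemma stable_transport (A L L' M M' : 'End(V)) T Ns Nu T2 Ns2 Nu2 :
  dichotomy C c L L' T Ns Nu -> dichotomy C c M M' T2 Ns2 Nu2 ->
  (forall v, A (L v) = M (A v)) -> (A @: Ns <= Ns2)%VS.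
Proof.
move=> dL dM ALM; apply/subvP => _ /memv_imgP[v vN ->].
apply: (decay_stable C0 c01 dM (K := entry_sum A * C * enorm v)) => [|k].
  by rewrite !mulr_ge0 ?entry_sum_ge0 ?enorm_ge0// ltW.
rewrite -(iter_conj ALM); apply: (le_trans (enorm_lfun_le _ _)).
rewrite -!mulrA ler_wpM2l ?entry_sum_ge0//; apply: (le_trans (dich_s dL k vN)).
by rewrite -mulrA [enorm v * _]mulrC.
Qed.

Lemma center_stable_transport (A L L' M M' : 'End(V)) T Ns Nu T2 Ns2 Nu2 v :
  dichotomy C c L L' T Ns Nu -> dichotomy C c M M' T2 Ns2 Nu2 ->
  (forall v, A (L v) = M (A v)) -> v \in T -> A v \in (T2 + Ns2)%VS.
Proof.
move=> dL dM ALM vT.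
apply: (slow_growth_center_stable C0 c01 dM (K := entry_sum A * C * enorm v)) => [|k].
  by rewrite !mulr_ge0 ?entry_sum_ge0 ?enorm_ge0// ltW.
rewrite -(iter_conj ALM); apply: (le_trans (enorm_lfun_le _ _)).
rewrite -!mulrA ler_wpM2l ?entry_sum_ge0//; apply: (le_trans (dich_T dL k vT)).
by rewrite -mulrA [enorm v * _]mulrC.
Qed.

(** T is the intersection of T + Ns and T + Nu, which are characterized by slow
    forward and slow backward growth. *)
Lemma dichotomy_transport (A L L' M M' : 'End(V)) T Ns Nu T2 Ns2 Nu2 :
  dichotomy C c L L' T Ns Nu -> dichotomy C c M M' T2 Ns2 Nu2 ->
  (forall v, A (L v) = M (A v)) ->
  [/\ (A @: T <= T2)%VS, (A @: Ns <= Ns2)%VS & (A @: Nu <= Nu2)%VS].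
Proof.
move=> dL dM ALM.
have dL' := dichotomy_inv dL; have dM' := dichotomy_inv dM.
have ALM' v : A (L' v) = M' (A v).
  by rewrite -[in RHS](dich_K' dL v) ALM (dich_K dM).
split; last 2 first.
- exact: stable_transport dL dM ALM.
- exact: stable_transport dL' dM' ALM'.
apply/subvP => _ /memv_imgP[v vT ->].
have /memv_addP[t tT [s sN AvE]] := center_stable_transport dL dM ALM vT.
have /memv_addP[t' tT' [u uN AvE']] := center_stable_transport dL' dM' ALM' vT.
suff s0 : s = 0 by rewrite AvE s0 addr0.
apply/eqP; rewrite -memv0 -(dich_disjs dM) memv_cap sN/=.
rewrite (_ : s = (t' - t) + u); first by rewrite memv_add// memvB.
by rewrite addrAC -AvE' AvE addrC addKr.
Qed.

End Conjugation.

Lemma limg_eq_dim (A : 'End(V)) (E E' : {vspace V}) : lker A == 0%VS ->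
  (A @: E <= E')%VS -> \dim E = \dim E' -> (A @: E = E')%VS.
Proof.
move=> /eqP A0 AE dE; apply/eqP; rewrite eqEdim AE /=.
by rewrite limg_dim_eq ?dE// A0 capv0.
Qed.

End Transport.

(** * Rates of the iterates *)

Section Rates.
Context {R : realType} {N : nat}.
Local Notation V := 'cV[R]_N.

Lemma mul_powR_le (x y c M sigma : R) (k l : nat) :
  1 <= M -> 0 <= c -> 0 <= x <= M * c ^+ k -> 0 <= y <= M * (1 + k%:R) ->
  0 <= sigma <= l%:R ->
  x * y `^ sigma <= M ^+ l.+1 * ((1 + k%:R) ^+ l * c ^+ k).
Proof.
move=> M1 c0 /andP[x0 xM] /andP[y0 yM] /andP[s0 sl].
have M0 : 0 <= M by exact: le_trans M1.
have k1 : 1 <= 1 + k%:R :> R by rewrite lerDl.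
rewrite exprS -mulrA [M ^+ l * _]mulrA -exprMn [_ * c ^+ k]mulrC mulrA.
apply: ler_pM => //; first exact: powR_ge0.
apply: (@le_trans _ _ ((M * (1 + k%:R)) `^ sigma)).
  by apply: ge0_ler_powR; rewrite // nnegrE// mulr_ge0// (le_trans ler01).
have Mk1 : 1 <= M * (1 + k%:R) by rewrite mulr_ege1.
by rewrite -powR_mulrn ?(le_trans ler01)// ler_powR.
Qed.

Section Factored.
Variables (C c b : R) (L L' B B' G : 'End(V)) (T Ns Nu : {vspace V}) (k : nat).
Hypothesis dich : dichotomy C c L L' T Ns Nu.
Hypotheses (BK : cancel B B') (Bb : entry_sum B <= b) (Bb' : entry_sum B' <= b).
Hypothesis GE : forall v, G v = B (iter k L v).

Lemma factored_K v : (G^-1)%VF (G v) = v.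
Proof.
apply: lker0_lfunK; apply/lker0P => x y; rewrite !GE => /(can_inj BK).
by move=> /(can_inj (iterK k (dich_K dich))).
Qed.

Let b0 : 0 <= b. Proof. exact: le_trans (entry_sum_ge0 _) Bb. Qed.

Lemma opnorm_on_factored (E : {vspace V}) (K : R) : 0 <= K ->
  (forall v, v \in E -> enorm (iter k L v) <= K * enorm v) ->
  opnorm_on G E <= b * K.
Proof.
move=> K0 KE; apply: opnorm_on_le; first exact: mulr_ge0.
move=> v vE; rewrite GE -mulrA; apply: (le_trans (enorm_lfun_le _ _)).
by apply: ler_pM; rewrite ?entry_sum_ge0 ?enorm_ge0 ?KE.
Qed.

Lemma opnorm_on_factored_inv (E : {vspace V}) (K : R) : 0 <= K ->
  (forall v, v \in E -> L v \in E) ->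
  (forall v, v \in E -> enorm (iter k L' v) <= K * enorm v) ->
  opnorm_on (G^-1)%VF (G @: E)%VS <= b * K.
Proof.
move=> K0 LE KE; apply: opnorm_on_le; first exact: mulr_ge0.
move=> _ /memv_imgP[v vE ->]; rewrite factored_K.
rewrite -[in leLHS](iterK k (dich_K dich) v).
apply: (le_trans (KE _ (iter_mem k LE vE))); rewrite [b * K]mulrC -mulrA.
rewrite ler_wpM2l// GE -[in leLHS](BK (iter k L v)).
by apply: (le_trans (enorm_lfun_le _ _)); rewrite ler_wpM2r ?enorm_ge0.
Qed.

End Factored.

(** Norms on T are at most M (1 + k) and those on Ns and Nu at most M c^k, where
    B and B' only contribute to M.  The constants are chosen before the maps, the
    exponents and sigma, hence serve all the points of an invariant manifold. *)
Lemma normal_rates (C c b : R) (l : nat) : 0 < C -> 0 < c < 1 -> 0 <= b ->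
  exists K a : R, [/\ 0 < K, 0 < a < 1 &
    forall (L L' B B' G : 'End(V)) (T Ns Nu : {vspace V}) (j k : nat) sigma,
      dichotomy C c L L' T Ns Nu -> cancel B B' ->
      entry_sum B <= b -> entry_sum B' <= b ->
      (forall v, G v = B (iter k L v)) -> (j <= k)%N -> 0 <= sigma <= l%:R ->
      opnorm_on G Ns * (opnorm_on (G^-1)%VF (G @: T)%VS) `^ sigma < K * a ^+ j /\
      opnorm_on (G^-1)%VF (G @: Nu)%VS * (opnorm_on G T) `^ sigma < K * a ^+ j].
Proof.
move=> C0 c01 b0; have [a [K [/andP[a0 a1] K0 aK]]] := poly_geometric_bound l c01.
have c0 : 0 <= c by case/andP: c01 => /ltW.
(* At least 1, so that powers with exponent sigma <= l are bounded by l-th powers. *)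
pose M := 1 + b * C.
have bC : 0 <= b * C by rewrite mulr_ge0// ltW.
have M1 : 1 <= M by rewrite lerDl.
have M0 : 0 < M by exact: lt_le_trans M1.
exists (M ^+ l.+1 * K + 1), a; split.
- by rewrite ltr_wpDl// mulr_ge0 ?exprn_ge0 ?(ltW M0) ?(ltW K0).
- by rewrite a0.
move=> L L' B B' G T Ns Nu j k sigma dich BK Bb Bb' GE jk sl.
have [iT iT'] := dich_invT dich; have [iu iu'] := dich_invu dich.
have bM (r : R) : 0 <= r -> b * (C * r) <= M * r.
  by move=> r0; rewrite mulrA ler_wpM2r// lerDr.
have ck : 0 <= c ^+ k by rewrite exprn_ge0.
have k1 : 0 <= 1 + k%:R :> R by rewrite addr_ge0.
have final x y : 0 <= x <= M * c ^+ k -> 0 <= y <= M * (1 + k%:R) ->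
    x * y `^ sigma < (M ^+ l.+1 * K + 1) * a ^+ j.
  move=> xM yM; apply: (le_lt_trans (mul_powR_le M1 c0 xM yM sl)).
  apply: (@le_lt_trans _ _ (M ^+ l.+1 * K * a ^+ j)); last first.
    by rewrite ltr_pM2r ?exprn_gt0// ltrDl.
  rewrite -mulrA ler_wpM2l ?exprn_ge0 ?(ltW M0)//; apply: (le_trans (aK k)).
  by rewrite ler_wpM2l ?(ltW K0)// ler_wiXn2l ?(ltW a0) ?(ltW a1).
split; apply: final; rewrite opnorm_on_ge0 /=.
- apply: le_trans (bM _ ck); apply: (opnorm_on_factored Bb GE) => [|v vE].
    by rewrite mulr_ge0// ltW.
  exact: dich_s dich _ _ vE.
- apply: le_trans (bM _ k1).
  apply: (opnorm_on_factored_inv dich BK Bb Bb' GE) => // [|v vE].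
    by rewrite mulr_ge0// ltW.
  exact: dich_T' dich _ _ vE.
- apply: le_trans (bM _ ck).
  apply: (opnorm_on_factored_inv dich BK Bb Bb' GE) => // [|v vE].
    by rewrite mulr_ge0// ltW.
  exact: dich_u dich _ _ vE.
- apply: le_trans (bM _ k1); apply: (opnorm_on_factored Bb GE) => [|v vE].
    by rewrite mulr_ge0// ltW.
  exact: dich_T dich _ _ vE.
Qed.

End Rates.

(** * Orbits that are closed modulo a translation *)

(** A t q stands for the differential of phi t at q, per q for the period of q
    modulo the translation by s. *)
Section Cocycle.
Context {R : realType} {N : nat}.
Local Notation V := 'cV[R]_N.
Variables (M : set V) (phi : R -> V -> V) (A : R -> V -> 'End(V)).
Variables (s : V) (per : V -> R) (Tm : R).
Hypotheses (M_phi : forall t q, M q -> M (phi t q))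
  (M_shift : forall (i : int) q, M q -> M (q + s *~ i))
  (phi_law : forall t u q, M q -> phi (u + t) q = phi u (phi t q))
  (phi_0 : forall q, M q -> phi 0 q = q)
  (phi_shift : forall (i : int) t q, M q -> phi t (q + s *~ i) = phi t q + s *~ i)
  (A_law : forall t u q, M q -> A (u + t) q = (A u (phi t q) \o A t q)%VF)
  (A_shift : forall (i : int) t q, M q -> A t (q + s *~ i) = A t q)
  (A_0 : forall q, M q -> A 0 q = \1%VF)
  (per_phi : forall t q, M q -> per (phi t q) = per q)
  (per_bound : forall q, M q -> 0 < per q <= Tm)
  (phi_per : forall q, M q -> phi (per q) q = q + s).

Lemma cocycle_lawE t u q v : M q -> A (u + t) q v = A u (phi t q) (A t q v).
Proof. by move=> Mq; rewrite A_law// comp_lfunE. Qed.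

Lemma cocycle_shift1 t q : M q -> A t (q + s) = A t q.
Proof. by move=> Mq; rewrite -[in RHS](A_shift 1 t Mq). Qed.

Lemma cocycleK t q : M q -> cancel (A t q) (A (- t) (phi t q)).
Proof.
by move=> Mq v; rewrite -cocycle_lawE// addNr A_0// id_lfunE.
Qed.

(** Over the quotient by s the orbit of q is closed, so that A (per q) q is
    its monodromy; moving the base point along the orbit conjugates it. *)
Lemma monodromy_conj t q v : M q ->
  A t q (A (per q) q v) = A (per (phi t q)) (phi t q) (A t q v).
Proof.
move=> Mq; rewrite per_phi// -cocycle_lawE// addrC cocycle_lawE// phi_per//.
by rewrite cocycle_shift1.
Qed.

Lemma phi_multiple k q : M q -> phi (k%:R * per q) q = q + s *~ k.
Proof.
move=> Mq; elim: k => [|k IH]; first by rewrite mul0r phi_0// mulr0z addr0.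
rewrite mulrSr mulrDl mul1r addrC phi_law// IH phi_shift// phi_per//.
by rewrite -addrA -[X in _ + (X + _)]mulr1z -mulrzDr.
Qed.

Lemma cocycle_multiple k q v : M q ->
  A (k%:R * per q) q v = iter k (A (per q) q) v.
Proof.
move=> Mq; elim: k => [|k IH]; first by rewrite mul0r A_0// id_lfunE.
rewrite mulrSr mulrDl mul1r addrC cocycle_lawE// phi_multiple// A_shift//.
by rewrite IH.
Qed.

(** Euclidean division of the time j Tm by the period of q: the quotient k is at
    least j as the period is at most Tm, and the remainder r is below the period. *)
Lemma cocycle_factor (j : nat) q : M q -> exists k r,
  [/\ (j <= k)%N, 0 <= r <= Tm &
    forall v, A (j%:R * Tm) q v = A r q (iter k (A (per q) q) v)].
Proof.
move=> Mq; have /andP[p0 pT] := per_bound Mq.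
have Tm0 : 0 < Tm by exact: lt_le_trans pT.
have x0 : 0 <= j%:R * Tm / per q by rewrite !mulr_ge0// ?invr_ge0 ltW.
pose k := Num.truncn (j%:R * Tm / per q).
have /andP[kx xk] : k%:R <= j%:R * Tm / per q < k.+1%:R.
  by apply/andP; split; [rewrite truncn_le|exact: truncnS_gt].
exists k, (j%:R * Tm - k%:R * per q); split.
- rewrite -ltnS -(@ltr_nat R); apply: le_lt_trans xk.
  by rewrite -mulrA ler_peMr// ler_pdivlMr// mul1r.
- rewrite subr_ge0 -ler_pdivlMr// kx /= (le_trans _ pT)//.
  by rewrite lerBlDr -[X in _ <= X + _]mul1r -mulrDl nat1r -ler_pdivrMr// ltW.
- move=> v; rewrite -cocycle_multiple//.
  rewrite -[in LHS](subrK (k%:R * per q) (j%:R * Tm)) cocycle_lawE//.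
  by rewrite phi_multiple// A_shift.
Qed.

End Cocycle.

Section PeriodicOrbitManifold.
Context {R : realType} {N : nat}.
Local Notation V := 'cV[R]_N.
Variables (k : nat) (X : V -> V) (W : set V) (D : set (R * V)).
Variables (Phi : R -> V -> V) (hPhi : is_flow k.+1 X W D Phi).
Variables (s : V) (M K : set V) (per : V -> R) (Tm : R).
Hypotheses
  (Xs : forall (i : int) q, W q -> W (q + s *~ i) /\ X (q + s *~ i) = X q)
  (M_dom : forall t q, M q -> D (t, q))
  (M_phi : forall t q, M q -> M (Phi t q))
  (K_compact : compact K)
  (MK : M = [set q | exists j : int, K (q + s *~ j)])
  (per_phi : forall t q, M q -> per (Phi t q) = per q)
  (per_bound : forall q, M q -> 0 < per q <= Tm)
  (phi_per : forall q, M q -> Phi (per q) q = q + s).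

Lemma M_shift (i : int) q : M q -> M (q + s *~ i).
Proof.
rewrite MK => -[j Kq]; exists (j - i).
by rewrite mulrzBr addrACA subrr addr0.
Qed.

Lemma M_shiftN q : M (q + s) -> M q.
Proof. by move=> /(M_shift (-1)); rewrite mulrN1z addrK. Qed.

Lemma Phi_shift (i : int) t q : D (t, q) ->
  D (t, q + s *~ i) /\ Phi t (q + s *~ i) = Phi t q + s *~ i.
Proof. by move=> Dt; exact (flow_translate hPhi (Xs i) Dt). Qed.

Lemma Phi_law t u q : M q -> Phi (u + t) q = Phi u (Phi t q).
Proof. by move=> Mq; have [] := flow_law hPhi (M_dom t Mq) (M_dom (u + t) Mq). Qed.

Lemma Phi_0 q : M q -> Phi 0 q = q.
Proof. by move=> /(M_dom 0) /(flow_dom hPhi) /(flow_init hPhi)[]. Qed.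

(** The inverse of D Phi_t is D Phi_(-t), whence the compact set [-Tm, Tm] x K;
    points outside K are translates of points of K. *)
Lemma M_Diff_bounded : exists2 b : R, 0 <= b & forall t q, 0 <= t <= Tm -> M q ->
  entry_sum (Diff (Phi t) q) <= b /\
  entry_sum (Diff (Phi (- t)) (Phi t q)) <= b.
Proof.
have KM : K `<=` M by move=> q Kq; rewrite MK; exists 0; rewrite mulr0z addr0.
have [] := @Diff_flow_bounded _ _ _ _ _ _ _ hPhi (`[- Tm, Tm] `*` K).
- apply: compact_setX => //; exact: segment_compact.
- by move=> [t q] [/= _ /KM /M_dom].
move=> b bP.
have bM t q : - Tm <= t <= Tm -> M q -> entry_sum (Diff (Phi t) q) <= b.
  move=> tT Mq; have := Mq; rewrite {1}MK => -[j Kq].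
  have E := @Diff_flow_translate _ _ _ _ _ _ _ hPhi _ (Xs j) t q (M_dom t Mq).
  by apply: le_trans (bP t _ (conj _ Kq)); [rewrite E|rewrite /= in_itv].
exists (`|b|) => // t q /andP[t0 tT] Mq.
by split; apply: le_trans (ler_norm b); apply: bM => //;
  [apply/andP; split; lra|apply/andP; split; lra|exact: M_phi].
Qed.

Lemma iter_Phi t j q : M q ->
  [/\ iter j (Phi t) q = Phi (j%:R * t) q,
      differentiable (iter j (Phi t)) q &
      Diff (iter j (Phi t)) q = Diff (Phi (j%:R * t)) q].
Proof.
move=> Mq; elim: j => [|j [E dE DE]].
  split; first by rewrite mul0r Phi_0.
    exact: ex_diff.
  rewrite mul0r; apply: (etrans (Diff_id q)); apply: esym.
  exact: (Diff_flow0 hPhi (flow_dom hPhi (M_dom 0 Mq))).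
have E1 : j.+1%:R * t = t + j%:R * t by rewrite -natr1 mulrDl mul1r addrC.
have dt : differentiable (Phi t) (iter j (Phi t) q).
  by rewrite E; apply: (flow_differentiable hPhi); apply: M_dom; exact: M_phi.
split.
- by rewrite iterS E E1 Phi_law.
- exact: differentiable_comp dE dt.
- rewrite E1; apply: etrans (Diff_comp dE dt) _.
  rewrite E; apply: etrans (congr1 (comp_lfun _) DE) _; apply: esym.
  exact: (Diff_flow_law hPhi (M_dom _ Mq) (M_dom _ Mq)).
Qed.

Let A t q : 'End(V) := Diff (Phi t) q.

Let A_law t u q : M q -> A (u + t) q = (A u (Phi t q) \o A t q)%VF.
Proof. by move=> Mq; exact: (Diff_flow_law hPhi (M_dom _ Mq) (M_dom _ Mq)). Qed.

Let A_shift (i : int) t q : M q -> A t (q + s *~ i) = A t q.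
Proof. by move=> Mq; exact (Diff_flow_translate hPhi (Xs i) (M_dom t Mq)). Qed.

Let A_0 q : M q -> A 0 q = \1%VF.
Proof. by move=> Mq; exact: (Diff_flow0 hPhi (flow_dom hPhi (M_dom 0 Mq))). Qed.

Let Phi_shiftM (i : int) t q : M q -> Phi t (q + s *~ i) = Phi t q + s *~ i.
Proof. by move=> Mq; have [] := Phi_shift i (M_dom t Mq). Qed.

(** The diffeomorphism is the flow at time Tm, which is at least every period.
    Along M the inclusions of [dichotomy_transport] are equalities, because the
    bases of each summand have the same length at all points. *)
Theorem periodic_orbits_normally_hyperbolic (dM dT ds du : nat)
    (T Ns Nu : V -> {vspace V}) (C c : R) (l : nat) :
  0 < Tm -> submanifold k.+1 dM M ->
  (forall q, M q -> is_tangent_space M q (T q)) ->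
  (forall q, M q -> splits (T q) (Ns q) (Nu q)) ->
  continuous_subspaces s M dT T ->
  continuous_subspaces s M ds Ns -> continuous_subspaces s M du Nu ->
  0 < C -> 0 < c < 1 ->
  (forall q, M q -> dichotomy C c (Diff (Phi (per q)) q)
     ((Diff (Phi (per q)) q)^-1)%VF (T q) (Ns q) (Nu q)) ->
  normally_hyperbolic_flow s k.+1 l D Phi M.
Proof.
move=> Tm0 subM tanM splitM cT cs cu C0 c01 dich.
have dimE E d : continuous_subspaces s M d E -> forall q, M q -> \dim (E q) = d.
  move=> [b [_ _ bE]] q Mq.
  by have /andP[/eqP <- /eqP ->] := bE q Mq; rewrite size_map size_enum_ord.
exists Tm => //; split.
- split; last by move=> q Dq; have [_] := Phi_shift 1 Dq.
  + move=> q /=; split => Dq; last by have [] := Phi_shift 1 Dq.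
    by have [] := Phi_shift (-1) Dq; rewrite mulrN1z addrK.
  + exact (flow_diffeo hPhi Tm).
- split.
  + by move=> q Mq; exact (M_dom Tm Mq).
  + by move=> q; split; [exact: M_shiftN|exact (@M_shift 1 q)].
  + by exists K.
  + by exists dM.
  + apply/seteqP; split => [_ [q Mq <-]|q Mq]; first exact: M_phi.
    exists (Phi (- Tm) q); first exact: M_phi.
    by rewrite -Phi_law// subrr Phi_0.
exists T, Ns, Nu; split => //; first by split; [exists ds|exists du].
- move=> q Mq; have MFq := M_phi Tm Mq.
  have conj v : A Tm q (A (per q) q v) = A (per (Phi Tm q)) (Phi Tm q) (A Tm q v).
    exact: (monodromy_conj (M := M) (phi := Phi) (s := s)).
  have [TT ss uu] := dichotomy_transport C0 c01 (dich q Mq) (dich _ MFq) conj.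
  have A0 : lker (A Tm q) == 0%VS.
    apply/lker0P; apply: can_inj (cocycleK (M := M) (phi := Phi) _ _ Tm Mq) => //.
  split.
  + exact: limg_eq_dim A0 TT (etrans (dimE _ _ cT _ Mq) (esym (dimE _ _ cT _ MFq))).
  + exact: limg_eq_dim A0 ss (etrans (dimE _ _ cs _ Mq) (esym (dimE _ _ cs _ MFq))).
  + exact: limg_eq_dim A0 uu (etrans (dimE _ _ cu _ Mq) (esym (dimE _ _ cu _ MFq))).
have [b b0 bP] := M_Diff_bounded.
have [K1 [a [K10 a01 rates]]] := @normal_rates R N C c b l C0 c01 b0.
exists K1, a; split => // sigma q j sl Mq.
have Phi_law' t u q' : M q' -> Phi (u + t) q' = Phi u (Phi t q').
  exact: Phi_law.
have [k' [r [jk r0T GE]]] : exists k' r, [/\ (j <= k')%N, 0 <= r <= Tm &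
    forall v, A (j%:R * Tm) q v = A r q (iter k' (A (per q) q) v)].
  by apply: (cocycle_factor (M := M) (phi := Phi) (s := s)) => // q'; exact: Phi_0.
have [_ _ ->] := iter_Phi Tm j Mq.
have [br br'] := bP r q r0T Mq.
have AK : cancel (A r q) (A (- r) (Phi r q)).
  exact: (cocycleK (M := M) (phi := Phi)).
exact (rates (A (per q) q) (A (per q) q)^-1%VF (A r q) (A (- r) (Phi r q))
  (A (j%:R * Tm) q) (T q) (Ns q) (Nu q) j k' sigma
  (dich q Mq) AK br br' GE jk sl).
Qed.

End PeriodicOrbitManifold.

(** * Periodicity of the Hamiltonian field *)

Lemma int_translations {R : realType} {V : lmodType R} (X : V -> V) (W : set V)
    (s : V) :
  (forall q, W (q + s) <-> W q) -> (forall q, W q -> X (q + s) = X q) ->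
  forall (i : int) q, W q -> W (q + s *~ i) /\ X (q + s *~ i) = X q.
Proof.
move=> Ws Xs.
have nat_case n q : (W (q + s *+ n) <-> W q) /\
    (W q -> X (q + s *+ n) = X q).
  elim: n => [|n [IH1 IH2]]; first by rewrite mulr0n addr0.
  rewrite mulrSr addrA; split; first by rewrite Ws.
  by move=> Wq; rewrite Xs ?IH2//; exact/IH1.
case=> n q Wq.
  by have [[_ Wn] Xn] := nat_case n q; split; [exact: Wn|exact: Xn].
have [[Wn _] Xn] := nat_case n.+1 (q - s *+ n.+1).
rewrite subrK in Wn Xn; rewrite NegzE mulrNz; split; first exact: Wn.
by rewrite Xn//; exact: Wn.
Qed.

Section Coordinates.
Context {R : realType} {k : nat}.
Implicit Types z w : 'cV[R]_(1 + k).

Lemma hdD z w : hd (z + w) = hd z + hd w.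
Proof. by rewrite /hd !mxE. Qed.

Lemma tlD z w : tl (z + w) = tl z + tl w.
Proof. by apply/matrixP => i j; rewrite !mxE. Qed.

Lemma hd_pt t (v : 'cV[R]_k) : hd (pt t v) = t.
Proof. by rewrite /hd /pt col_mxKu mxE eqxx mulr1n. Qed.

Lemma tl_pt t (v : 'cV[R]_k) : tl (pt t v) = v.
Proof. by rewrite /tl /pt col_mxKd. Qed.

Lemma hd_tl_inj z w : hd z = hd w -> tl z = tl w -> z = w.
Proof.
move=> hzw tzw; rewrite -(vsubmxK z) -(vsubmxK w); congr col_mx => //.
by apply/matrixP => i j; rewrite !ord1.
Qed.

Lemma norm_pt0_le (v : 'cV[R]_k) : `|pt 0 v| <= `|v|.
Proof.
rewrite [leLHS]/Num.norm /= mx_normrE; apply: bigmax_le => // -[i j] _ /=.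
rewrite /pt mxE; case: (fintype.split i) => i'; last exact: coord_le_norm.
by rewrite mxE mul0rn normr0.
Qed.

Lemma pt0_continuous : continuous (@pt R k 0).
Proof.
move=> v; apply: (iffRL (@pseudometric_normed_Zmodule.cvgrPdist_lt _ _ _
  (nbhs v) _ (@pt R k 0) (pt 0 v))) => e e0.
apply/nbhs_ballP; exists e => // w; rewrite -ball_normE /= => vw.
rewrite (_ : pt 0 v - pt 0 w = pt 0 (v - w)).
  exact: le_lt_trans (norm_pt0_le _) vw.
rewrite /pt opp_col_mx add_col_mx; congr col_mx.
by apply/matrixP => i j; rewrite !mxE !mul0rn subrr.
Qed.

End Coordinates.

Section HamiltonianPeriodicity.
Context {R : realType}.
Variables (d m : nat) (S : @transverse_system R d m) (rho0 : R).
Variables (Q : R -> 'M[R]_d) (Rw : 'M[R]_m).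
Hypotheses (A_per1 : periodic1 (A S)) (Q_per1 : periodic1 Q).
Hypothesis (fg_per1 : forall x, tube rho0 x ->
    [/\ f0 S (x + unit_shift _) = f0 S x, g0 S (x + unit_shift _) = g0 S x,
        fa S (x + unit_shift _) = fa S x & ga S (x + unit_shift _) = ga S x]).
Local Notation phase := 'cV[R]_(1 + (d + (1 + d))).
Local Notation W := (phase_domain (d := d) rho0).
Implicit Types z : phase.

Lemma hd_shift k (z : 'cV[R]_(1 + k)) : hd (z + unit_shift _) = hd z + 1.
Proof. by rewrite hdD hd_pt. Qed.

Lemma tl_shift k (z : 'cV[R]_(1 + k)) : tl (z + unit_shift _) = tl z.
Proof. by rewrite tlD tl_pt addr0. Qed.

Lemma xs_shift z : xs (z + unit_shift _) = xs z + unit_shift _.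
Proof.
apply: hd_tl_inj; rewrite ?hd_shift ?tl_shift /xs ?hd_pt ?tl_pt ?hd_shift//.
by rewrite /xa tl_shift.
Qed.

Lemma phase_domain_shift z : W (z + unit_shift _) <-> W z.
Proof. by rewrite /phase_domain /tube /= xs_shift tl_shift. Qed.

Lemma Ham_shift z : W z -> Ham S Q Rw (z + unit_shift _) = Ham S Q Rw z.
Proof.
move=> Wz; have [f0E g0E faE gaE] := fg_per1 Wz.
rewrite /Ham /Gvec xs_shift f0E g0E faE gaE hd_shift A_per1 Q_per1.
by rewrite /p0 /pa /xa tl_shift.
Qed.

(** Periodicity holds on the open set W only, which suffices for the partial
    derivatives at its points. *)
Lemma Ham_field_shift z : open W -> W z ->
  Ham_field S Q Rw (z + unit_shift _) = Ham_field S Q Rw z.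
Proof.
move=> oW Wz; suff E : grad (Ham S Q Rw) (z + unit_shift _) = grad (Ham S Q Rw) z.
  by rewrite /Ham_field E.
apply/matrixP => i j; rewrite !mxE.
rewrite (@derive_along _ _ _ _ _ (Ham S Q Rw \o shift (unit_shift _)) _ z _
  (delta_mx i 0)); last by move=> h; rewrite /= addrA.
apply: near_eq_derive.
have := open_nbhs_nbhs (conj oW Wz).
by apply: filterS => w /= /Ham_shift.
Qed.

End HamiltonianPeriodicity.

(** * A continuous family of closed orbits *)

(** h is a continuous extension of the base points b, the form in which the
    smoothness of b on a closed interval is given. *)
Section ClosedOrbitFamily.
Context {R : realType} {V : normedModType R}.
Variables (k : nat) (X : V -> V) (W : set V) (D : set (R * V)).
Variables (Phi : R -> V -> V) (hPhi : is_flow k X W D Phi).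
Variables (s : V) (b h : R -> V) (tau : R -> R) (eps Tm : R).
Hypotheses
  (Xs : forall (i : int) q, W q -> W (q + s *~ i) /\ X (q + s *~ i) = X q)
  (h_continuous : continuous h) (bh : forall e, `|e| <= eps -> b e = h e)
  (b_dom : forall e t, `|e| <= eps -> D (t, b e))
  (tau_bound : forall e, `|e| <= eps -> 0 < tau e <= Tm)
  (b_per : forall e, `|e| <= eps -> Phi (tau e) (b e) = b e + s).

Let M : set V := [set z | exists2 e, `|e| <= eps & exists t, z = Phi t (b e)].

Lemma orbit_law e t u : `|e| <= eps -> Phi (u + t) (b e) = Phi u (Phi t (b e)).
Proof.
by move=> he; have [] := flow_law hPhi (b_dom t he) (b_dom (u + t) he).
Qed.

Lemma orbit_dom e t u : `|e| <= eps -> D (u, Phi t (b e)).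
Proof.
by move=> he; have [] := flow_law hPhi (b_dom t he) (b_dom (u + t) he).
Qed.

Lemma orbit_multiple e t n : `|e| <= eps ->
  Phi (t + n%:R * tau e) (b e) = Phi t (b e) + s *+ n.
Proof.
move=> he; elim: n => [|n IH]; first by rewrite mul0r !addr0.
rewrite mulrSr mulrDl mul1r addrA orbit_law// b_per//.
have [_] := flow_translate hPhi (Xs 1) (b_dom (t + n%:R * tau e) he).
by rewrite mulr1z IH => ->; rewrite -addrA -mulrSr.
Qed.

Lemma orbits_shift_nat q n : M q -> M (q + s *+ n) /\ M (q - s *+ n).
Proof.
move=> [e he [t ->]]; split; exists e => //.
  by exists (t + n%:R * tau e); rewrite orbit_multiple.
exists (t - n%:R * tau e); apply: (canLR (addrK _)).
by rewrite -orbit_multiple// subrK.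
Qed.

Lemma orbits_unshift (j : int) q : M (q + s *~ j) -> M q.
Proof.
case: j => n Mq.
  by have [_] := orbits_shift_nat n Mq; rewrite addrK.
by have [+ _] := orbits_shift_nat n.+1 Mq; rewrite NegzE mulrNz subrK.
Qed.

(** The arcs of one period sweep out a compact set, whose translates are the
    whole orbits. *)
Lemma orbits_compact_mod : 0 <= Tm -> exists2 K : set V, compact K &
  M = [set q | exists j : int, K (q + s *~ j)].
Proof.
move=> Tm0; pose F (et : R * R) := Phi et.2 (h et.1).
exists (F @` (`[- eps, eps] `*` `[0, Tm])).
  apply: continuous_compact.
    apply: continuous_in_subspaceT => -[e t]; rewrite inE => -[/= he _].
    have {}he : `|e| <= eps by rewrite ler_norml; move: he; rewrite in_itv.
    pose G (et : R * R) : R * V := (et.2, h et.1).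
    apply: (@continuous_comp _ _ _ G (fun tq : R * V => Phi tq.1 tq.2)).
      have c1 : {for (e, t), continuous (fun et : R * R => h et.1)}.
        apply: (@continuous_comp _ _ _ (fun et : R * R => et.1) h).
          exact: cvg_fst.
        exact: h_continuous.
      have c2 : {for (e, t), continuous (fun et : R * R => et.2)}.
        exact: cvg_snd.
      exact: (cvg_pair c2 c1).
    have DG : D (G (e, t)) by rewrite /G /= -bh//; exact: b_dom.
    exact (Ck_continuous (flow_Ck hPhi) DG).
  by apply: compact_setX; exact: segment_compact.
apply/seteqP; split => [_ [e he [t ->]]|q [j [[e t] [/= he _] Fq]]]; last first.
  have {}he : `|e| <= eps by rewrite ler_norml; move: he; rewrite in_itv.
  apply: (@orbits_unshift j); exists e => //; exists t.
  by rewrite -Fq /F /= bh.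
have /andP[p0 pT] := tau_bound he.
pose n := Num.truncn (`|t| / tau e); pose t1 := t + n.+1%:R * tau e.
(* Only nonnegative multiples of the period are available, so t is first moved to
   a nonnegative time t1. *)
have t10 : 0 <= t1.
  have : `|t| < n.+1%:R * tau e by rewrite -ltr_pdivrMr// truncnS_gt.
  by rewrite ltr_norml => /andP[+ _]; rewrite /t1; lra.
pose m := Num.truncn (t1 / tau e).
have x0 : 0 <= t1 / tau e by rewrite divr_ge0// ltW.
have mt1 : m%:R * tau e <= t1 by rewrite -ler_pdivlMr// truncn_le.
have t1m : t1 < m.+1%:R * tau e by rewrite -ltr_pdivrMr// truncnS_gt.
exists (n.+1%:Z - m%:Z); exists (e, t1 - m%:R * tau e).
  split; rewrite /= in_itv /=; first by rewrite -ler_norml.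
  by move: t1m; rewrite -natr1 mulrDl mul1r; apply: contraTT => ?; lra.
rewrite /F /= -bh// mulrzBr -!pmulrn.
apply: (@addIr _ (s *+ m)); rewrite -orbit_multiple// subrK.
by rewrite addrA subrK -orbit_multiple.
Qed.

End ClosedOrbitFamily.

(** * Normal hyperbolicity of the manifold *)

(** By the intermediate value theorem f keeps the sign of f 0. *)
Lemma positive_bounded_segment {R : realType} (f : R -> R) (eps : R) :
  continuous f -> 0 < f 0 -> (forall e, `|e| <= eps -> f e != 0) ->
  0 <= eps -> exists2 Tm, 0 < Tm & forall e, `|e| <= eps -> 0 < f e <= Tm.
Proof.
move=> fc f0 fN0 eps0.
have [|c _ fM] := @EVT_max R f (- eps) eps _ (continuous_subspaceT fc); first lra.
have {}fM e : `|e| <= eps -> f e <= f c.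
  by rewrite ler_norml => he; apply: fM; rewrite in_itv.
exists (f c); first by apply: lt_le_trans f0 (fM _ _); rewrite normr0.
move=> e he; rewrite fM// andbT ltNge; apply/negP => fe.
pose g := f \o ( *%R^~ e).
have gc : continuous g.
  move=> u; apply: continuous_comp; last exact: fc.
  exact: mulrr_continuous.
have [|u] := @IVT R g 0 1 0 (@ler01 R) (continuous_subspaceT gc).
  by rewrite /g /= mul0r mul1r ge_min le_max fe (ltW f0) orbT.
rewrite in_itv /= => /andP[u0 u1] /eqP; apply/negP/fN0.
by rewrite normrM ger0_norm// (le_trans _ he)// ler_piMl.
Qed.

Lemma Ck_segment_continuous {R : realType} {W : normedModType R} k (a b : R)
    (f : R -> W) : Ck_segment k a b f ->
  exists2 h : R -> W, continuous h & forall t, a <= t <= b -> f t = h t.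
Proof. by move=> [h Ch fh]; exists h => // t; exact: Ck_continuous Ch I. Qed.

Theorem theorem2 (R : realType) (n m r : nat)
  (hn : (2 <= n)%N) (hm : (1 <= m)%N) (hr : (4 <= r)%N)
  (f : 'cV[R]_n -> 'cV[R]_n) (g : 'cV[R]_n -> 'M[R]_(n, m))
  (hf : Ck r setT f) (hg : Ck r setT g)
  (gamma : R -> 'cV[R]_n) (Z : R -> 'M[R]_(n, n.-1))
  (horbit : periodic_orbit r f gamma Z)
  (rho0 : R) (hrho0 : 0 < rho0) (S : transverse_system n.-1 m)
  (hS : transverse_form r f g gamma Z rho0 S)
  (Q : R -> 'M[R]_n.-1) (Rw : 'M[R]_m)
  (hQ : Ck r setT Q) (hQper : periodic1 Q) (hQpos : forall t, pos_semidef (Q t))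
  (hRw : pos_def Rw)
  (D : set (R * 'cV[R]_(1 + (n.-1 + (1 + n.-1)))))
  (Phi : R -> 'cV[R]_(1 + (n.-1 + (1 + n.-1))) ->
         'cV[R]_(1 + (n.-1 + (1 + n.-1))))
  (hPhi : is_flow (r - 3) (Ham_field S Q Rw) (phase_domain rho0) D Phi)
  (hRic : exists P : R -> 'M[R]_n.-1, stabilizing_solution S Q Rw P)
  (eps1 : R) (tau : R -> R) (a : R -> 'cV[R]_(n.-1 + (1 + n.-1)))
  (hfam : periodic_family S Q Rw D Phi r eps1 tau a)
  (eps2 : R) (heps2 : 0 < eps2 < eps1)
  (hM : submanifold (r - 1) 2 (Mfd Phi a eps2))
  (hsplit : monodromy_splitting Phi tau a eps2) :
  forall rho : nat,
    normally_hyperbolic_flow (unit_shift _) (r - 3) rho D Phi (Mfd Phi a eps2).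
Proof.
have [k kE] : exists k, (r - 3 = k.+1)%N by exists (r - 4)%N; lia.
rewrite kE in hPhi *.
set d := n.-1 in S hS Q hQ hQper hQpos D Phi hPhi hRic a hfam hM hsplit *.
pose s : 'cV[R]_(1 + (d + (1 + d))) := unit_shift _.
have Wshift q : phase_domain rho0 (q + s) <-> phase_domain rho0 q.
  exact: phase_domain_shift.
have Xshift q : phase_domain rho0 q ->
    Ham_field S Q Rw (q + s) = Ham_field S Q Rw q.
  apply: (Ham_field_shift Rw (A_per hS) hQper (fg_per hS)).
  exact: open_dom hPhi.
have Xs := int_translations Wshift Xshift.
have [eps20 eps21] := andP heps2.
have eps12 (e : R) : `|e| <= eps2 -> `|e| <= eps1.
  by move=> /le_trans; apply; exact: ltW.
have seg (e : R) : `|e| <= eps2 -> - eps1 <= e <= eps1.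
  by move=> /eps12; rewrite ler_norml.
have [ha hac aE] := Ck_segment_continuous (a_Ck hfam).
have [ht htc tE] := Ck_segment_continuous (tau_Ck hfam).
pose b e : 'cV[R]_(1 + (d + (1 + d))) := pt 0 (a e).
have b_dom e t : `|e| <= eps2 -> D (t, b e).
  by move=> /eps12; exact: (family_dom hfam).
have Phi0b e : `|e| <= eps2 -> Phi 0 (b e) = b e.
  by move=> he; have [] := flow_init hPhi (flow_dom hPhi (b_dom e 0 he)).
have hb e : `|e| <= eps2 -> hd (Phi (tau e) (b e)) = 1.
  by move=> /eps12 /(family_x0 hfam 1); rewrite mul1r.
have b_per e : `|e| <= eps2 -> Phi (tau e) (b e) = b e + s.
  move=> he; apply: hd_tl_inj; first by rewrite hb// hd_shift hd_pt add0r.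
  by rewrite tl_shift -[in RHS](Phi0b e he) -(family_per hfam 0 (eps12 _ he)) add0r.
(* A zero period would make x_0 equal to 0 and 1 at once. *)
have tauN0 e : `|e| <= eps2 -> ht e != 0.
  move=> he; rewrite -tE ?seg//; apply/eqP => te.
  have := hb e he; rewrite te Phi0b// hd_pt => /eqP.
  by rewrite eq_sym oner_eq0.
have [Tm Tm0 tauT] : exists2 Tm, 0 < Tm & forall e, `|e| <= eps2 -> 0 < tau e <= Tm.
  have [|Tm Tm0 hT] := positive_bounded_segment htc _ tauN0 (ltW eps20).
    by rewrite -tE ?(tau0 hfam)// seg// normr0 ltW.
  by exists Tm => // e he; rewrite tE ?seg// hT.
have ME : Mfd Phi a eps2 =
    [set z | exists2 e, `|e| <= eps2 & exists t, z = Phi t (b e)].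
  apply/seteqP; split => [z [e he [t _ <-]]|z [e he [t ->]]].
    by exists e => //; exists t.
  by exists e => //; exists t.
have [K cK MK] : exists2 K, compact K &
    Mfd Phi a eps2 = [set q | exists j : int, K (q + s *~ j)].
  rewrite ME; apply: (@orbits_compact_mod _ _ _ _ _ _ _ hPhi s b
    (fun e => pt 0 (ha e)) tau eps2 Tm Xs _ _ b_dom tauT b_per (ltW Tm0)).
    move=> e; apply: (@continuous_comp _ _ _ ha (@pt R _ 0)); first exact: hac.
    exact: pt0_continuous.
  by move=> e he; rewrite /b aE// seg.
(* The period is a function of the point because the energy is the parameter. *)
pose per q := tau (Ham S Q Rw q).
have perE e t : `|e| <= eps2 -> per (Phi t (b e)) = tau e.
  move=> he; congr tau; apply: (family_energy hfam (eps12 _ he)).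
  by exists t.
have [T [Ns [Nu [tanM splitM [cT cs cu] [C [c [C0 c01 bounds]]]]]]] := hsplit.
move=> rho.
apply: (@periodic_orbits_normally_hyperbolic _ _ k _ _ _ _ hPhi s
  (Mfd Phi a eps2) K per Tm Xs _ _ cK MK _ _ _ 2 2 d d T Ns Nu C c rho) => //.
- by rewrite ME => t q [e he [u ->]]; exact: (orbit_dom hPhi b_dom).
- rewrite ME => t q [e he [u ->]]; exists e => //; exists (t + u).
  by rewrite (orbit_law hPhi b_dom).
- rewrite ME => t q [e he [u ->]].
  by rewrite -(orbit_law hPhi b_dom)// !perE.
- by rewrite ME => q [e he [u ->]]; rewrite perE// tauT.
- rewrite ME => q [e he [u ->]]; rewrite perE//.
  rewrite -(orbit_law hPhi b_dom)// addrC.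
  by have := orbit_multiple hPhi Xs b_dom b_per u 1 he; rewrite mul1r.
- by apply: submanifold_le hM; lia.
- move=> q Mq; have [e he Gq] := Mq.
  have [inv bT bs bu] := bounds e q he Gq.
  have -> : per q = tau e by have [t _ <-] := Gq; exact: perE.
  exact: (dichotomy_of_splitting (splitM q Mq) inv bT bs bu).
Qed.
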